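(* Let $\mathbf{X}_1,\ldots,\mathbf{X}_n$ be a sample from a distribution $F$, modeled with prior $F\sim DP(a,H)$, so that the posterior is $F^{\mathrm{pos}}:=F\mid\mathbf{X}_{1:n}\sim DP(a+n,H^{\ast})$, and let $F^{\mathrm{pos}}_N$ be its $N$-term approximation. Consider a generator family $\{Gen_{\boldsymbol{\omega}}\}_{\boldsymbol{\omega}\in\boldsymbol{\Omega}}$ and let $\boldsymbol{\omega}^{\star}_{\mathrm{BNPL}}\in\boldsymbol{\Omega}$ be the optimized generator parameter, i.e. a minimizer of $\boldsymbol{\omega}\mapsto \mathrm{WMMD}(F^{\mathrm{pos}}_N,F_{Gen_{\boldsymbol{\omega}}})$ over $\boldsymbol{\Omega}$. Assume: (1) (well-specified case) there is a parameter value $\boldsymbol{\omega}_{\mathrm{True}}\in\boldsymbol{\Omega}$ with $\mathrm{WMMD}(F,F_{Gen_{\boldsymbol{\omega}_{\mathrm{True}}}})=0$; (2) $k(\cdot,\cdot)$ is a continuous kernel function whose feature space corresponds to a universal reproducing kernel Hilbert space, defined on a compact metric space $\mathfrak{X}$, and $|k(t,t')|<K$ for all $t,t'\in\mathbb{R}^d$; (3) there is a finite constant $M>0$ such that $\max\left(\mathrm{W}(F,F_{\mathbf{X}_{1:n}}),\mathrm{W}(F,H^{\ast})\right)<M$ for every $n\in\mathbb{N}$. Then, as $n,N\to\infty$, $$\limsup E\left[\mathrm{WMMD}\left(F,F_{Gen_{\boldsymbol{\omega}^{\star}_{\mathrm{BNPL}}}}\right)\right]=0 .$$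
   Context: The data space is $\mathfrak{X}\subset\mathbb{R}^d$, a compact metric space. $DP(a,H)$ denotes the Dirichlet process with (fixed) concentration parameter $a>0$ and base probability measure $H$. The posterior base measure is $H^{\ast}=\frac{a}{a+n}H+\frac{n}{a+n}F_{\mathbf{X}_{1:n}}$, where $F_{\mathbf{X}_{1:n}}$ is the empirical distribution of $\mathbf{X}_1,\ldots,\mathbf{X}_n$. The $N$-term approximation of $F^{\mathrm{pos}}$ is $F^{\mathrm{pos}}_{N}=\sum_{i=1}^{N}J^{\mathrm{pos}}_{i,N}\delta_{\mathbf{X}^{\mathrm{pos}}_i}$, where $\mathbf{X}^{\mathrm{pos}}_{1},\ldots,\mathbf{X}^{\mathrm{pos}}_{N}\overset{i.i.d.}{\sim}H^{\ast}$ and, independently of these, $(J^{\mathrm{pos}}_{1,N},\ldots,J^{\mathrm{pos}}_{N,N})\sim\mathrm{Dirichlet}\left(\frac{a+n}{N},\ldots,\frac{a+n}{N}\right)$. $\{Gen_{\boldsymbol{\omega}}\}_{\boldsymbol{\omega}\in\boldsymbol{\Omega}}$ is a family of neural network functions from $\mathbb{R}^p$ to $\mathbb{R}^d$ ($p<d$), parameterized by $\boldsymbol{\omega}$ in a compact set $\boldsymbol{\Omega}\subset\mathbb{R}^{t_1}$. $F_{Gen_{\boldsymbol{\omega}}}$ denotes the distribution of $Gen_{\boldsymbol{\omega}}(\mathbf{Z})$, where $\mathbf{Z}$ is a latent noise vector in $\mathbb{R}^p$ (standard Gaussian). For probability measures $F_1,F_2$ on the data space: - $\mathrm{W}(F_1,F_2)=\sup_{D}\left(E_{F_1}[D(\mathbf{X})]-E_{F_2}[D(\mathbf{Y})]\right)$,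 the supremum being over all real-valued 1-Lipschitz functions $D$ on $\mathfrak{X}$ (Wasserstein distance in Kantorovich–Rubinstein form); - $\mathrm{MMD}(F_1,F_2)=\|\mu_{F_1}-\mu_{F_2}\|_{\mathcal{H}_k}$, where $\mathcal{H}_k$ is the reproducing kernel Hilbert space of the kernel $k$ and $\mu_{F}=E_F[k(\mathbf{X},\cdot)]$ is the kernel mean embedding; equivalently $\mathrm{MMD}^2(F_1,F_2)=E[k(\mathbf{X},\mathbf{X}')]-2E[k(\mathbf{X},\mathbf{Y})]+E[k(\mathbf{Y},\mathbf{Y}')]$ with $\mathbf{X},\mathbf{X}'\overset{i.i.d.}{\sim}F_1$ and $\mathbf{Y},\mathbf{Y}'\overset{i.i.d.}{\sim}F_2$; - $\mathrm{WMMD}(F_1,F_2)=\mathrm{W}(F_1,F_2)+\mathrm{MMD}(F_1,F_2)$. The expectation in the conclusion is over all randomness (the data and the posterior draws on which $\boldsymbol{\omega}^{\star}_{\mathrm{BNPL}}$ depends). *)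

(* Defs.v *)
From HB Require Import structures.
From mathcomp Require Export all_boot all_order all_algebra.
From mathcomp Require Export all_classical all_reals all_analysis.
Export Order.TTheory GRing.Theory Num.Theory numFieldNormedType.Exports.

Set Implicit Arguments.
Unset Strict Implicit.
Unset Printing Implicit Defensive.

Local Open Scope classical_set_scope.
Local Open Scope ring_scope.

(* Real matrices, in particular the vectors of R^d = 'rV[R]_d, carry their
   Borel sigma-algebra. *)
HB.instance Definition _ (R : realType) (m n : nat) :=
  @isMeasurable.Build (sigma_display (@open 'M[R]_(m, n))) 'M[R]_(m, n)
    <<s @open 'M[R]_(m, n) >>
    (@sigma_algebra0 _ setT _)
    (@sigma_algebraC _ _) (@sigma_algebra_bigcup _ setT _).

Section discrepancies.
Context {R : realType} {d : nat}.
Implicit Types (S : set 'rV[R]_d) (F : {measure set 'rV[R]_d -> \bar R}).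

(* The library norm on 'rV[R]_d is the sup norm. *)
Definition enorm (x : 'rV[R]_d) : R := Num.sqrt (\sum_i x ord0 i ^+ 2).

Definition lipschitz1 S : set ('rV[R]_d -> R) :=
  [set D | forall x y, S x -> S y -> `|D x - D y| <= enorm (x - y)].

(* The data space is the set S, and probability measures on it are represented
   by Borel measures on R^d giving S mass 1. Test functions matter only on S.
   Because the constants are 1-Lipschitz, two measures which give S different
   (finite) masses are at infinite distance. *)
Definition W S F1 F2 : \bar R :=
  ereal_sup [set (\int[F1]_(x in S) (D x)%:E - \int[F2]_(x in S) (D x)%:E)%E
            | D in lipschitz1 S].

Context {H : completeNormedModType R}.
Implicit Types (k : 'rV[R]_d -> 'rV[R]_d -> R) (ev : H -> 'rV[R]_d -> R).

(* H is the reproducing kernel Hilbert space of functions on S whose kernel is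
   the restriction of k to S * S: the element f stands for the function
   x |-> ev f x on S (the values of ev f outside S are irrelevant), and kx is
   k(x, .). By Moore-Aronszajn such an H exists iff k is a symmetric positive
   semidefinite kernel on S, and it is then unique up to isometry. *)
Definition is_rkhs S k (dot : {dot H for idfun}) ev : Prop :=
  [/\ forall f, dot f f = `|f| ^+ 2,
      forall c f g x, S x -> ev (c *: f + g) x = c * ev f x + ev g x,
      forall f g, (forall x, S x -> ev f x = ev g x) -> f = g &
      forall x, S x -> exists2 kx : H,
        forall y, S y -> ev kx y = k x y & forall f, dot f kx = ev f x].

(* With k continuous on the compact S the functions of H are continuous on S,
   and universality is their uniform density in C(S). *)
Definition universal S ev : Prop :=
  forall g : 'rV[R]_d -> R, {within S, continuous g} ->
  forall e : R, 0 < e -> exists f : H, forall x, S x -> `|ev f x - g x| < e.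

(* E_F[k(X, .)], as an element of H; an RKHS has at most one. *)
Definition mean_embedding S k ev F : H :=
  get [set m | forall y, S y ->
    (ev m y)%:E = (\int[F]_(x in S) (k x y)%:E)%E].

Definition MMD S k ev F1 F2 : R :=
  `|mean_embedding S k ev F1 - mean_embedding S k ev F2|.

Definition WMMD S k ev F1 F2 : \bar R := (W S F1 F2 + (MMD S k ev F1 F2)%:E)%E.

End discrepancies.

Section laws.
Context {R : realType}.

(* mu is the law of a vector with independent coordinates, the i-th one having
   law (nu i). *)
Definition product_law n (nu : 'I_n -> set R -> \bar R)
    (mu : probability 'rV[R]_n R) : Prop :=
  forall B : 'I_n -> set R, (forall i, measurable (B i)) ->
  mu [set z | forall i, B i (z ord0 i)] = (\prod_(i < n) nu i (B i))%E.

Definition Gamma (s : R) : R :=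
  fine (\int[lebesgue_measure]_(x in `]0, +oo[) (x `^ (s - 1) * expR (- x))%:E).

Definition gamma_law (s : R) (B : set R) : \bar R :=
  (((Gamma s)^-1)%:E * \int[lebesgue_measure]_(x in B `&` `]0%R, +oo[)
     (x `^ (s - 1) * expR (- x))%:E)%E.

(* Ferguson's definition: the Dirichlet law is the law of
   (z_1, ..., z_n) / (z_1 + ... + z_n) for independent z_i ~ Gamma(alpha_i, 1). *)
Definition dirichlet_law n (alpha : 'I_n -> R) (mu : probability 'rV[R]_n R) :
    Prop :=
  exists2 g : probability 'rV[R]_n R,
    product_law (fun i => gamma_law (alpha i)) g &
    forall C, measurable C ->
      mu C = g [set z : 'rV[R]_n | C ((\sum_i z ord0 i)^-1 *: z)].

End laws.

Section sampling.
Context {R : realType} {d : nat}.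
Local Notation E := 'rV[R]_d.
Context {dT : measure_display} {T : measurableType dT}.
Implicit Types (P : probability T R).

Definition iid P (X : nat -> T -> E) (F : {measure set E -> \bar R}) : Prop :=
  forall n (B : nat -> set E), (forall i, measurable (B i)) ->
  P [set t | forall i, (i < n)%N -> B i (X i t)] = (\prod_(i < n) F (B i))%E.

Definition empirical (x : nat -> E) (n : nat) : {measure set E -> \bar R} :=
  mscale (n%:R^-1)%:nng (msum (fun i => \d_(x i)) n).

(* The base measure H^* of the posterior DP(a + n, H^* ) given the data
   x 0, ..., x n.-1. *)
Definition post_base (a : {posnum R}) (H : {measure set E -> \bar R})
    (x : nat -> E) (n : nat) : {measure set E -> \bar R} :=
  measure_add (mscale (a%:num / (a%:num + n%:R))%:nng H)
              (mscale (n%:R / (a%:num + n%:R))%:nng (empirical x n)).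

(* Only the atoms y i and the weights w i with i < N are used. The weights
   that are fed to it are almost surely nonnegative; the absolute value only
   makes the result a measure everywhere. *)
Definition atomic (y : nat -> E) (w : nat -> R) (N : nat) :
    {measure set E -> \bar R} :=
  msum (fun i => mscale `|w i|%:nng \d_(y i)) N.

(* Atoms Y and weights J of the N-term approximation of DP(c, Q), where Q is a
   random measure that depends on the sample X_0, ..., X_{n-1}: conditionally
   on this sample, Y_0, ..., Y_{N-1} are i.i.d. with law Q and, independently
   of them, (J_0, ..., J_{N-1}) is Dirichlet(c/N, ..., c/N). The law of J does
   not depend on the sample. *)
Definition DP_approx_draws P n (X : 'I_n -> T -> E) (c : R)
    (Q : T -> {measure set E -> \bar R}) N (Y : nat -> T -> E)
    (J : nat -> T -> R) : Prop :=
  exists2 D : probability 'rV[R]_N R,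
    dirichlet_law (fun=> c / N%:R) D &
    forall (A : set T) (B : 'I_N -> set E) (C : set 'rV[R]_N),
      g_sigma_preimage X A -> (forall i, measurable (B i)) -> measurable C ->
      P (A `&` [set t | forall i : 'I_N, B i (Y i t)]
           `&` [set t | C (\row_(i < N) J i t)])
      = (D C * \int[P]_(t in A) (\prod_(i < N) Q t (B i)))%E.

End sampling.

(* Main.v *)
Require Import Defs.
From HB Require Import structures.
From mathcomp Require Import all_boot all_order all_algebra.
From mathcomp Require Import all_classical all_reals all_analysis.
From mathcomp Require Import measurable_realfun.
From mathcomp Require Import ring lra.

(* Write G* for the selected generator law, G for the true one and Fpos for the
   posterior approximation. By the triangle inequality and minimality,
   WMMD(F, G* ) <= 2 WMMD(F, Fpos) + WMMD(F, G) = 2 WMMD(F, Fpos), so it suffices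
   that E[WMMD(F, Fpos)] -> 0.

   Cut the compact S into finitely many Borel pieces A_j on which every
   1-Lipschitz function and the feature map x |-> k(x, .) vary by at most e.
   Replacing F and Fpos by discrete measures carried by one point per piece gives
   WMMD(F, Fpos) <= 4 e + sum_j C_j |F(A_j) - Fpos(A_j)| almost surely.

   For a Borel set A, Fpos(A) - F(A) = sum_i J_i (1_A(Y_i) - F(A)), and
   independence of J and Y yields
   E[(Fpos(A) - F(A))^2] <= E[(H^*(A) - F(A))^2] + E[sum_i J_i^2].
   The first term is O(1/n) by the variance bound for the empirical frequency.
   For the second, J is z / sum z with z a vector of independent
   Gamma((a + n)/N) variables, and Chebyshev's inequality for sum z gives
   4/N + 8/(a + n). *)

Set Implicit Arguments.
Unset Strict Implicit.
Unset Printing Implicit Defensive.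

Import Order.TTheory GRing.Theory Num.Theory numFieldNormedType.Exports.
Local Open Scope classical_set_scope.
Local Open Scope ring_scope.

(** * Integrals *)

(** A finite partition replaces the suprema over test functions by finitely many frequencies, so an
    L2 bound for each fixed Borel set is enough and no uniform law over a class of functions enters.
    L2 bounds become L1 bounds through |x| <= dl + x^2 / dl, with dl fixed before n and N. Two
    obstacles shape the statements. The selected parameter is an arbitrary function of the outcome,
    so the integrand of the final expectation may fail to be measurable; it is compared almost
    surely with a measurable bound. The weights form a probability vector only almost surely, so
    second moments are taken of the clamped weights min(|J_i|, 1), which are bounded at every
    outcome. The atoms are independent only given the data, which is why the bound contains
    E[(H^*(A) - F(A))^2] and not the square of a mean. For the Dirichlet weights, bounding the ratio
    z / sum z takes only the first two moments of gamma variables, hence only Gamma(s + 1) = s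
    Gamma(s) and no Beta integral. *)

Section integrals.
Context d (T : measurableType d) (R : realType).
Local Open Scope ereal_scope.

Import HBNNSimple.

(* [f] need not be measurable: its integral is a supremum over the simple
   functions below it. *)
Lemma ae_le_integral_measurable (mu : {measure set T -> \bar R})
    (f g : T -> \bar R) :
  (forall x, 0 <= f x) -> (forall x, 0 <= g x) ->
  measurable_fun [set: T] g ->
  {ae mu, forall x, f x <= g x} -> \int[mu]_x f x <= \int[mu]_x g x.
Proof.
move=> f0 g0 mg fg; rewrite ge0_integralTE//.
apply: ge_ereal_sup => _ [h hf <-].
rewrite -integralT_nnsfun; apply: ae_ge0_le_integral => //.
- by move=> x _; rewrite lee_fin.
- exact/measurable_EFinP.
- by apply: filterS fg => x fgx _; exact: le_trans (hf x) fgx.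
Qed.

(** Simple functions increasing to [f] reduce the claim, by monotone convergence on both sides, to
    indicators, where it is the hypothesis on [nu]. It serves with a gamma density and with the
    indicator of an event as [h]. *)
Lemma ge0_integral_density (mu nu : {measure set T -> \bar R}) (h : T -> R)
    (f : T -> \bar R) :
  (forall x, (0 <= h x)%R) -> measurable_fun [set: T] h ->
  (forall A, measurable A -> nu A = \int[mu]_(x in A) (h x)%:E) ->
  (forall x, 0 <= f x) -> measurable_fun [set: T] f ->
  \int[nu]_x f x = \int[mu]_x (f x * (h x)%:E).
Proof.
move=> h0 mh nuE f0 mf.
pose g := nnsfun_approx measurableT mf.
have gf x : (EFin \o g n) x @[n --> \oo] --> f x by exact: cvg_nnsfun_approx.
have mhE : measurable_fun setT (EFin \o h) by exact/measurable_EFinP.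
have -> : \int[nu]_x f x = lim (\int[nu]_x (EFin \o g n) x @[n --> \oo]).
  under eq_integral => x _ do rewrite -(cvg_lim _ (gf x))//.
  apply: monotone_convergence => //.
  - by move=> n; exact/measurable_EFinP.
  - by move=> n x _; rewrite lee_fin.
  - by move=> x _ a b ab; rewrite lee_fin; exact/lefP/nd_nnsfun_approx.
have -> : \int[mu]_x (f x * (h x)%:E) =
    lim (\int[mu]_x ((EFin \o g n) x * (h x)%:E) @[n --> \oo]).
  have gfh x : ((EFin \o g n) x * (h x)%:E) @[n --> \oo] --> f x * (h x)%:E.
    exact: cvgeZr.
  under eq_integral => x _ do rewrite -(cvg_lim _ (gfh x))//.
  apply: monotone_convergence => //.
  - by move=> n; apply/emeasurable_funM => //; exact/measurable_EFinP.
  - by move=> n x _; rewrite mule_ge0 ?lee_fin.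
  - by move=> x _ a b ab; rewrite lee_wpmul2r ?lee_fin//; exact/lefP/nd_nnsfun_approx.
suff E n : \int[nu]_x (EFin \o g n) x = \int[mu]_x ((EFin \o g n) x * (h x)%:E).
  by under eq_fun do rewrite E.
transitivity (\int[nu]_x
   (\sum_(y \in range (g n)) (y * \1_(g n @^-1` [set y]) x)%:E)).
  by apply: eq_integral => t _; rewrite /= fimfunE -fsumEFin.
have mi m r : measurable_fun setT (fun x => (r * \1_(g m @^-1` [set r]) x)%:E).
  by apply: (measurable_comp measurableT) => //; exact: measurable_funM.
rewrite ge0_integral_fsum//; last by move=> m y _; exact: nnfun_muleindic_ge0.
transitivity (\int[mu]_x (\sum_(y \in range (g n))
    (y * \1_(g n @^-1` [set y]) x)%:E * (h x)%:E)); last first.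
  apply: eq_integral => x _.
  rewrite -ge0_mule_fsuml => [|y]; last exact: nnfun_muleindic_ge0.
  by rewrite fsumEFin // -(fimfunE _ x).
rewrite ge0_integral_fsum//; last 2 first.
  - by move=> y; exact: emeasurable_funM.
  - move=> m y _; apply: mule_ge0; last by rewrite lee_fin.
    exact: nnfun_muleindic_ge0.
apply: eq_fsbigr => r; rewrite inE => -[x0 _ r0].
have rge0 : (0 <= r)%R by rewrite -r0.
under eq_integral do rewrite EFinM.
under [RHS]eq_integral do rewrite EFinM -muleA.
rewrite !ge0_integralZl ?lee_fin//; last 3 first.
- apply: emeasurable_funM => //; exact/measurable_EFinP.
- by move=> x _; rewrite mule_ge0 ?lee_fin.
- exact/measurable_EFinP.
congr (_ * _); rewrite integral_indic// setIT nuE//.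
by rewrite [LHS]integral_mkcond; apply: eq_integral => x _; rewrite muleC epatch_indic.
Qed.


(** Independence identifies the law of [(U, V)] with the product of the two laws, and Tonelli splits
    the integral. The absolute value in [f] makes the integrand nonnegative on the whole plane, not
    only on the range of [(U, V)]. *)
Lemma ge0_expectationM_indep (P : probability T R) (U V : T -> R) :
  (forall t, (0 <= U t)%R) -> (forall t, (0 <= V t)%R) ->
  measurable_fun [set: T] U -> measurable_fun [set: T] V ->
  (forall A B, measurable A -> measurable B ->
    P (U @^-1` A `&` V @^-1` B) = P (U @^-1` A) * P (V @^-1` B)) ->
  \int[P]_t (U t * V t)%:E = (\int[P]_t (U t)%:E) * (\int[P]_t (V t)%:E).
Proof.
move=> U0 V0 mU mV indep.
pose mUi := isMeasurableFun.Build _ _ _ _ _ mU.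
pose mVi := isMeasurableFun.Build _ _ _ _ _ mV.
pose U' : {mfun T >-> R} := HB.pack U mUi.
pose V' : {mfun T >-> R} := HB.pack V mVi.
have mUV : measurable_fun [set: T] (fun t => (U t, V t)).
  exact: measurable_fun_pair.
pose mUVi := isMeasurableFun.Build _ _ _ _ _ mUV.
pose UV : {mfun T >-> (R * R)%type} := HB.pack (fun t => (U t, V t)) mUVi.
pose f (z : R * R) : \bar R := `|(z.1 * z.2)%:E|.
have mf : measurable_fun [set: R * R] f.
  apply: measurableT_comp => //; apply/measurable_EFinP.
  by apply: measurable_funM; [exact: measurable_fst | exact: measurable_snd].
have f0 z : 0 <= f z by exact: abse_ge0.
have -> : \int[P]_t (U t * V t)%:E = \int[distribution P UV]_z f z.
  rewrite ge0_integral_distribution//; apply: eq_integral => t _ /=.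
  by rewrite /f /= ger0_norm ?mulr_ge0.
have -> : \int[distribution P UV]_z f z =
    \int[distribution P U' \x distribution P V']_z f z.
  apply: eq_measure_integral => A mA _; apply/esym.
  by apply: product_measure_unique => // B C mB mC.
rewrite fubini_tonelli1//.
have mabs : measurable_fun [set: R] (fun x : R => `|x|%:E : \bar R).
  by apply/measurable_EFinP; exact: normr_measurable.
have EU : \int[distribution P U']_x `|x|%:E = \int[P]_t (U t)%:E.
  rewrite ge0_integral_distribution//.
  by apply: eq_integral => t _ /=; rewrite ger0_norm.
have EV : \int[distribution P V']_x `|x|%:E = \int[P]_t (V t)%:E.
  rewrite ge0_integral_distribution//.
  by apply: eq_integral => t _ /=; rewrite ger0_norm.
rewrite -EU -EV /fubini_F /=.
under eq_integral => x _.
  under eq_integral => y _ do rewrite /f /= normrM EFinM.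
  rewrite ge0_integralZl//.
  over.
by rewrite /= ge0_integralZr// integral_ge0.
Qed.

End integrals.

(** * Gamma and Dirichlet laws *)

Section gamma.
Context {R : realType}.
Notation mu := (@lebesgue_measure R).

Let g (s x : R) := x `^ (s - 1) * expR (- x).

Lemma ge0_gamma_integrand (s x : R) : 0 <= x `^ (s - 1) * expR (- x).
Proof. by rewrite mulr_ge0 ?powR_ge0 ?expR_ge0. Qed.

Lemma measurable_gamma_integrand (s : R) :
  measurable_fun [set: R] (fun x : R => x `^ (s - 1) * expR (- x)).
Proof.
apply: measurable_funM; first exact: measurable_powR.
by apply: measurableT_comp => //; exact: measurable_funN.
Qed.

Let h (s x : R) := x `^ s * expR (- x).

Let dh (s x : R) : 0 < x -> is_derive x 1 (h s) (s * g s x - g (s + 1) x).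
Proof.
move=> x0; have dp := is_derive1_powR s x0.
have de : is_derive x 1 (fun y => expR (- y)) (- expR (- x)).
  by apply: is_derive_eq; rewrite mulrN1 /=.
apply: is_derive_eq; rewrite /g addrK /GRing.scale /=; ring.
Qed.

Let cvg_h0 (s : R) : 0 < s -> h s n.+1%:R^-1 @[n --> \oo] --> (0 : R).
Proof.
move=> s0; apply: (@squeeze_cvgr _ _ _ _ (cst 0) (fun n => n.+1%:R^-1 `^ s)).
- near=> n; rewrite mulr_ge0 ?powR_ge0 ?expR_ge0//=.
  by rewrite ler_piMr ?powR_ge0// expR_le1 oppr_le0.
- exact: cvg_cst.
- have /cvg_at_rightP := @powR_cvg0 R s s0; apply.
  by split; [move=> n; rewrite invr_gt0 | exact: cvg_harmonic].
Unshelve. all: by end_near. Qed.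

(** For an integer m >= s, the bound e^x >= x^(m+1) / (m+1)! leaves at most (m+1)! / x of x^s e^(-x)
    when x >= 1. *)
Let cvg_hy (s : R) : 0 < s -> h s n.+1%:R @[n --> \oo] --> (0 : R).
Proof.
move=> s0; pose m := (Num.truncn s).+1.
have sm : s <= m%:R by rewrite ltW// truncnS_gt.
apply: (@squeeze_cvgr _ _ _ _ (cst 0) (fun n => m.+1`!%:R * n.+1%:R^-1)).
- near=> n; rewrite mulr_ge0 ?powR_ge0 ?expR_ge0//=.
  have n1 : 1 <= n.+1%:R :> R by rewrite ler1n.
  rewrite /h expRN ler_pdivrMr ?expR_gt0//.
  apply: (@le_trans _ _ (n.+1%:R ^+ m)).
    by rewrite -powR_mulrn// ler_powR.
  rewrite -mulrA -ler_pdivrMl ?ltr0n ?fact_gt0//.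
  rewrite ler_pdivlMl ?ltr0n//.
  apply: le_trans (@expR_ge1Dxn R n.+1%:R m (ler0n _ _)).
  by rewrite mulrCA -exprS mulrC lerDr ler01.
- exact: cvg_cst.
- rewrite -[X in _ --> X](mulr0 (m.+1`!%:R)); apply: cvgMr; exact: cvg_harmonic.
Unshelve. all: by end_near. Qed.

Let G s := (\int[mu]_(x in `]0%R, +oo[) (g s x)%:E)%E.

(* Integration by parts on [1 / (n + 1), n + 1], then n -> oo. *)
Lemma Gamma_integralS (s : R) : 0 < s ->
  (\int[mu]_(x in `]0%R, +oo[) (x `^ (s + 1 - 1) * expR (- x))%:E =
   s%:E * \int[mu]_(x in `]0%R, +oo[) (x `^ (s - 1) * expR (- x))%:E)%E.
Proof.
move=> s0; rewrite -/(G (s + 1)) -/(G s).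
pose I (n : nat) := `[n.+1%:R^-1 : R, n.+1%:R]%classic.
have mI n : measurable (I n) by exact: measurable_itv.
have ndI : nondecreasing_seq I.
  move=> m n mn; rewrite subsetEset => x; rewrite /I /= !in_itv/= => /andP[a b].
  rewrite (le_trans _ a) ?(le_trans b) ?ler_nat// lef_pV2 ?posrE ?ltr0n//.
  by rewrite ler_nat.
have UI : \bigcup_n I n = `]0, +oo[%classic.
  apply/seteqP; split => x /=.
    move=> [n _]; rewrite /I /= !in_itv/= andbT => /andP[+ _].
    by apply: lt_le_trans; rewrite invr_gt0.
  rewrite in_itv/= andbT => x0; exists (maxn (Num.truncn x) (Num.truncn x^-1)) => //=.
  rewrite /I /= in_itv/=; apply/andP; split.
    rewrite invf_ple ?posrE ?ltr0n// ltW// (lt_le_trans (truncnS_gt _))//.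
    by rewrite ler_nat ltnS leq_maxr.
  rewrite ltW// (lt_le_trans (truncnS_gt _))//.
  by rewrite ler_nat ltnS leq_maxl.
have I0 n x : I n x -> 0 < x.
  by rewrite /I/= in_itv/= => /andP[+ _]; apply: lt_le_trans; rewrite invr_gt0.
have mg r n : measurable_fun (I n) (EFin \o g r).
  by apply/measurable_EFinP; apply: measurable_funTS; exact: measurable_gamma_integrand.
have cv r : (\int[mu]_(x in I n) (g r x)%:E)%E @[n --> \oo] --> G r.
  rewrite /G -UI; apply: ge0_nondecreasing_set_cvg_integral => //.
    by move=> n; exact: mg.
  by move=> n x _; rewrite lee_fin ge0_gamma_integrand.
have cg r n : {within I n, continuous (g r)}.
  apply: continuous_in_subspaceT => x /[!inE] /I0 x0.
  have dp := is_derive1_powR (r - 1) x0.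
  have de : is_derive x 1 (fun y => expR (- y)) (- expR (- x)).
    by apply: is_derive_eq; rewrite mulrN1 /=.
  apply: differentiable_continuous; apply/derivable1_diffP.
  by apply: derivableM; apply: ex_derive.
have ig r n : mu.-integrable (I n) (EFin \o g r).
  by apply: continuous_compact_integrable => //; exact: segment_compact.
(* For n = 0 the interval shrinks to the point 1, and the fundamental theorem asks for distinct
   endpoints. *)
have E n : (0 < n)%N -> (s%:E * (\int[mu]_(x in I n) (g s x)%:E) =
    (\int[mu]_(x in I n) (g (s + 1) x)%:E) + (h s n.+1%:R - h s n.+1%:R^-1)%:E)%E.
  move=> n0.
  have n1 : n.+1%:R^-1 < n.+1%:R :> R.
    by rewrite (@lt_trans _ _ 1)// ?invf_lt1// ltr1n.
  have : (\int[mu]_(x in I n) (s * g s x - g (s + 1) x)%:E =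
      (h s n.+1%:R)%:E - (h s n.+1%:R^-1)%:E)%E.
    apply: continuous_FTC2 => //.
    - by move=> x; apply: cvgB; [apply: cvgMr; exact: cg | exact: cg].
    - split.
      + move=> x /[!in_itv]/= /andP[a _].
        have xx : 0 < x by apply: lt_trans a; rewrite invr_gt0.
        by apply: ex_derive; exact: dh.
      + apply/cvg_at_right_filter/differentiable_continuous/derivable1_diffP.
        by apply: ex_derive; apply: dh; rewrite invr_gt0.
      + apply/cvg_at_left_filter/differentiable_continuous/derivable1_diffP.
        by apply: ex_derive; apply: dh.
    - move=> x /[!in_itv]/= /andP[a _].
      have xx : 0 < x by apply: lt_trans a; rewrite invr_gt0.
      by rewrite derive1E; have := dh s xx => -[_ ->].
  rewrite EFinB => <-.
  have -> : (\int[mu]_(x in I n) (s * g s x - g (s + 1) x)%:E =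
      s%:E * \int[mu]_(x in I n) (g s x)%:E
      - \int[mu]_(x in I n) (g (s + 1) x)%:E)%E.
    under eq_integral do rewrite EFinB EFinM.
    have i1 : mu.-integrable (I n) (fun x => s%:E * (g s x)%:E)%E.
      by apply: integrableZl; [exact: mI|exact: ig].
    rewrite integralB; [|exact: mI|exact: i1|exact: ig].
    by rewrite integralZl; [|exact: mI|exact: ig].
  rewrite addeC subeK//.
  by apply: integrable_fin_num; [exact: mI|exact: ig].
(* The limit is taken in the extended reals, where [G s] may still be infinite. *)
have cvL : (s%:E * (\int[mu]_(x in I n) (g s x)%:E))%E @[n --> \oo] --> (s%:E * G s)%E.
  exact: cvgeZl.
have cvR : ((\int[mu]_(x in I n) (g (s + 1) x)%:E) +
    (h s n.+1%:R - h s n.+1%:R^-1)%:E)%E @[n --> \oo] --> (G (s + 1) + 0%:E)%E.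
  apply: cvgeD; [by rewrite fin_num_adde_defl | exact: cv |].
  apply: cvg_EFin; first by near=> n.
  rewrite -[X in _ --> X](subrr (0 : R)).
  by apply: cvgB; [exact: cvg_hy|exact: cvg_h0].
rewrite adde0 in cvR; symmetry; apply: cvg_unique cvL _ => //.
apply: cvg_trans cvR; apply: near_eq_cvg; near=> n; apply/esym/E.
near: n; exact: nbhs_infty_gt.
Unshelve. all: by end_near. Qed.

End gamma.

(** Each integral depends only on the image of the measure on the real line, and the two images
    differ by the factor [c]. The factor is 1 when a Dirichlet integral is pulled back to gamma
    variables, and P(G) when an integral is restricted to an event G. *)
Lemma ge0_integral_eq_law d1 (T1 : measurableType d1) d2 (T2 : measurableType d2)
    (R : realType) (m1 : {measure set T1 -> \bar R})
    (m2 : {measure set T2 -> \bar R}) (c : {nonneg R}) (U1 : T1 -> R) (U2 : T2 -> R) :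
  measurable_fun [set: T1] U1 -> measurable_fun [set: T2] U2 ->
  (forall t, 0 <= U1 t) -> (forall t, 0 <= U2 t) ->
  (forall B, measurable B ->
    m1 (U1 @^-1` B) = (c%:num%:E * m2 (U2 @^-1` B))%E) ->
  (\int[m1]_t (U1 t)%:E = c%:num%:E * \int[m2]_t (U2 t)%:E)%E.
Proof.
move=> mU1 mU2 U10 U20 E.
have mabs : measurable_fun [set: R] (fun x : R => `|x|%:E : \bar R).
  by apply/measurable_EFinP; exact: normr_measurable.
have a0 (x : R) : (0 <= `|x|%:E)%E by rewrite lee_fin.
pose mUi1 := isMeasurableFun.Build _ _ _ _ _ mU1.
pose mUi2 := isMeasurableFun.Build _ _ _ _ _ mU2.
pose V1 : {mfun T1 >-> R} := HB.pack U1 mUi1.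
pose V2 : {mfun T2 >-> R} := HB.pack U2 mUi2.
have aux d (T : measurableType d) (m : {measure set T -> \bar R})
    (U : {mfun T >-> R}) : (forall t, 0 <= U t) ->
    (\int[m]_t (U t)%:E = \int[pushforward m U]_x `|x|%:E)%E.
  move=> U0; rewrite [RHS]ge0_integral_pushforward//.
  by apply: eq_integral => t _ /=; rewrite ger0_norm.
rewrite (aux _ _ m1 V1)// (aux _ _ m2 V2)//.
rewrite -[RHS](ge0_integral_mscale (pushforward m2 V2) measurableT c)//.
by apply: eq_measure_integral => B mB _; exact: E.
Qed.

Lemma continuous_rV_measurable (R : realType) (n : nat) (f : 'rV[R]_n -> R) :
  continuous f -> measurable_fun [set: 'rV[R]_n] f.
Proof.
move=> /continuousP cf.
apply: (measurability _ (RGenOpens.measurableE R)) => _ [_ [a [b ->]] <-].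
rewrite setTI; apply: sub_sigma_algebra; apply: cf; exact: interval_open.
Qed.

Lemma measurable_coord (R : realType) (n : nat) (i : 'I_n) :
  measurable_fun [set: 'rV[R]_n] (fun z : 'rV[R]_n => z ord0 i).
Proof. by apply: continuous_rV_measurable; exact: coord_continuous. Qed.

(** Inversion is not continuous at 0, so 1 / f is written as f (|f|^(-1))^2 with a measurable real
    power. At a zero of f both sides are 0, since [0^-1 = 0]. *)
Lemma measurable_funV d (T : measurableType d) (R : realType) (f : T -> R) :
  measurable_fun [set: T] f -> measurable_fun [set: T] (fun t => (f t)^-1).
Proof.
move=> mf.
rewrite (_ : (fun _ => _) = (fun t => f t * (`|f t| `^ (-1)) ^+ 2)).
  apply: measurable_funM => //; apply: measurable_funX.
  apply: (@measurableT_comp _ _ _ _ _ _ (fun x : R => x `^ (-1)) _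
    (fun t => `|f t|)); first exact: measurable_powR.
  by apply: measurableT_comp; first exact: normr_measurable.
apply/funext => t; rewrite powR_inv1// exprVn -normrX ger0_norm ?sqr_ge0//.
have [->|ft0] := eqVneq (f t) 0; first by rewrite invr0 mul0r.
by rewrite expr2 invfM mulrA divff// mul1r.
Qed.

Lemma measurable_ratio (R : realType) (n : nat) (i : 'I_n) :
  measurable_fun [set: 'rV[R]_n] (fun z : 'rV[R]_n => z ord0 i / \sum_j z ord0 j).
Proof.
apply: measurable_funM; first exact: measurable_coord.
by apply: measurable_funV; apply: measurable_sum => j; exact: measurable_coord.
Qed.

Lemma measurable_min_norm1 d (T : measurableType d) (R : realType) (f : T -> R) :
  measurable_fun [set: T] f ->
  measurable_fun [set: T] (fun t => Order.min `|f t| 1).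
Proof.
move=> mf; apply: measurable_minr => //.
by apply: measurableT_comp; first exact: normr_measurable.
Qed.

Lemma ge0_integral_sumr d (T : measurableType d) (R : realType)
    (m : {measure set T -> \bar R}) (I : finType) (f : I -> T -> R) :
  (forall i, measurable_fun [set: T] (f i)) -> (forall i t, 0 <= f i t) ->
  (\int[m]_t (\sum_i f i t)%:E = \sum_i \int[m]_t (f i t)%:E)%E.
Proof.
move=> mf f0; under eq_integral do rewrite -sumEFin.
rewrite ge0_integral_sum//.
- by move=> i; exact/measurable_EFinP.
- by move=> i t _; rewrite lee_fin.
Qed.

Section real_valued_integrals.
Context d (T : measurableType d) (R : realType) (m : {measure set T -> \bar R}).
Implicit Types f h : T -> R.

Lemma ge0_integralDr f h :
  measurable_fun [set: T] f -> measurable_fun [set: T] h ->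
  (forall t, 0 <= f t) -> (forall t, 0 <= h t) ->
  (\int[m]_t (f t + h t)%:E = \int[m]_t (f t)%:E + \int[m]_t (h t)%:E)%E.
Proof.
move=> mf mh f0 h0; under eq_integral do rewrite EFinD.
by rewrite ge0_integralD//; try (by move=> t _; rewrite lee_fin); exact/measurable_EFinP.
Qed.

Lemma ge0_integralZlr k f :
  measurable_fun [set: T] f -> 0 <= k -> (forall t, 0 <= f t) ->
  (\int[m]_t (k * f t)%:E = k%:E * \int[m]_t (f t)%:E)%E.
Proof.
move=> mf k0 f0; under eq_integral do rewrite EFinM.
by rewrite ge0_integralZl//; try (by move=> t _; rewrite lee_fin); exact/measurable_EFinP.
Qed.

End real_valued_integrals.

(** * Moments and ratios of independent gamma variables *)

Section gamma_vector.
Context {R : realType} (N : nat) (s : R) (g : probability 'rV[R]_N R).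
Hypotheses (N0 : (0 < N)%N) (s0 : 0 < s).
Hypothesis hg : product_law (fun=> gamma_law s) g.
Notation mu := (@lebesgue_measure R).
Local Notation dens r := (fun x : R => x `^ (r - 1) * expR (- x)).

Let G r := (\int[mu]_(x in `]0%R, +oo[) (dens r x)%:E)%E.

Let G_ge0 r : (0 <= G r)%E.
Proof. by apply: integral_ge0 => x _; rewrite lee_fin ge0_gamma_integrand. Qed.

(* Since [fine +oo = 0] and [0^-1 = 0], an infinite or zero integral in
   [Gamma s] would make [gamma_law s] the zero measure, which is impossible as
   its powers are the marginals of the probability [g]. *)
Let gamma_setT_neq0 : gamma_law s [set: R] <> 0%E.
Proof.
move=> E; have := hg (B := fun=> setT) (fun=> measurableT).
rewrite (_ : [set z | _] = setT); last by apply/seteqP; split.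
rewrite probability_setT.
under eq_bigr do rewrite E.
case: N N0 => // n _; rewrite big_ord_recl mul0e => /eqP.
by rewrite onee_eq0.
Qed.

Let Gamma_fin : G s = (Gamma s)%:E /\ Gamma s != 0.
Proof.
have gs0 : Gamma s != 0.
  by apply/eqP => E; apply: gamma_setT_neq0; rewrite /gamma_law E invr0 mul0e.
split=> //; move: gs0; rewrite (_ : Gamma s = fine (G s))//.
by move: (G_ge0 s); case: (G s) => //= _; rewrite eqxx.
Qed.

Let Gamma_ge0 : 0 <= (Gamma s)^-1.
Proof. by rewrite invr_ge0 /Gamma fine_ge0// -/(G s). Qed.

Let gamma_setT : gamma_law s [set: R] = 1%E.
Proof.
have [E n0] := Gamma_fin.
by rewrite /gamma_law setTI -/(G s) E -EFinM mulVf.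
Qed.

Let marginal i B : measurable B -> g [set z | B (z ord0 i)] = gamma_law s B.
Proof.
move=> mB; pose C j := if j == i then B else setT.
have := hg (B := C); rewrite (_ : [set z | forall k, C k (z ord0 k)] =
    [set z | B (z ord0 i)]); last first.
  apply/seteqP; split => z /=; first by move=> /(_ i); rewrite /C eqxx.
  by move=> Bz j; rewrite /C; case: eqP => [->|].
move=> ->; last by move=> j; rewrite /C; case: ifP.
rewrite (bigD1 i)//= big1 ?mule1 /C ?eqxx// => j ji.
by rewrite (negbTE ji) gamma_setT.
Qed.

Let marginal2 i j A B : i != j -> measurable A -> measurable B ->
  g ([set z | A (z ord0 i)] `&` [set z | B (z ord0 j)]) =
    (gamma_law s A * gamma_law s B)%E.
Proof.
move=> ij mA mB; pose C k := if k == i then A else if k == j then B else setT.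
have := hg (B := C); rewrite (_ : [set z | forall k, C k (z ord0 k)] =
    [set z | A (z ord0 i)] `&` [set z | B (z ord0 j)]); last first.
  apply/seteqP; split => z /=.
    move=> Cz; split; first by have := Cz i; rewrite /C eqxx.
    by have := Cz j; rewrite /C eqxx eq_sym (negbTE ij).
  by move=> [Az Bz] k; rewrite /C; case: eqP => [->//|_]; case: eqP => [->|].
move=> ->; last by move=> k; rewrite /C; case: ifP => // _; case: ifP.
rewrite (bigD1 i)//= (bigD1 j) 1?eq_sym//= big1 ?mule1 /C ?eqxx.
  by rewrite eq_sym (negbTE ij).
by move=> k /andP[ki kj]; rewrite (negbTE ki) (negbTE kj) gamma_setT.
Qed.

Let gamma_law_le0 : gamma_law s `]-oo, 0]%classic = 0%E.
Proof.
rewrite /gamma_law (_ : _ `&` _ = set0) ?integral_set0 ?mule0//.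
apply/seteqP; split => x //= []; rewrite !in_itv/= andbT => x0.
by rewrite ltNge x0.
Qed.

(** The gamma law does not charge the nonpositive half line. Hence the normalizing sum is almost
    surely positive, and z / sum z is a genuine point of the simplex. *)
Lemma gamma_coord_gt0 : {ae g, forall z : 'rV[R]_N, forall i, 0 < z ord0 i}.
Proof.
apply: filter_forall => i.
exists [set z : 'rV[R]_N | `]-oo, 0]%classic (z ord0 i)]; split.
- rewrite -[X in measurable X]setTI.
  exact: (measurable_coord i measurableT (measurable_itv _)).
- by apply: etrans gamma_law_le0; apply: marginal; exact: measurable_itv.
- by move=> z /= /negP; rewrite -leNgt in_itv/=.
Qed.

Let integral_coord i (f : R -> R) : (forall x, 0 <= f x) ->
  measurable_fun [set: R] f ->
  (\int[g]_z (f (z ord0 i))%:E =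
   (Gamma s)^-1%:E * \int[mu]_(x in `]0%R, +oo[) (f x * dens s x)%:E)%E.
Proof.
move=> f0 mf.
(* [lebesgue_measure] lives on the line with the sigma-algebra generated by half-open intervals;
   [RL] gives the pushforward of [g] that same domain. *)
pose RL := g_sigma_algebraType (R.-ocitv.-measurable).
have mz : @measurable_fun _ _ 'rV[R]_N RL setT (fun z : 'rV[R]_N => z ord0 i).
  exact: (measurable_coord i).
pose mc := isMeasurableFun.Build _ _ _ _ _ mz.
pose c : {mfun 'rV[R]_N >-> RL} := HB.pack (fun z : 'rV[R]_N => z ord0 i) mc.
have mfE : measurable_fun [set: RL] (EFin \o f) by exact/measurable_EFinP.
have -> : (\int[g]_z (f (z ord0 i))%:E = \int[pushforward g c]_x (f x)%:E)%E.
  by rewrite ge0_integral_pushforward// => x _; rewrite lee_fin.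
pose h x := (Gamma s)^-1 * ((dens s) \_ `]0, +oo[) x.
have d0 r x : 0 <= ((dens r) \_ `]0, +oo[) x.
  by rewrite patchE; case: ifP => // _; exact: ge0_gamma_integrand.
have md : measurable_fun [set: RL] ((dens s) \_ `]0, +oo[).
  apply/(measurable_restrictT _ (measurable_itv _)).
  by apply: measurable_funTS; exact: measurable_gamma_integrand.
have h0 x : 0 <= h x by rewrite mulr_ge0.
have mh : measurable_fun [set: RL] h by exact: measurable_funM.
rewrite (@ge0_integral_density _ RL _ mu (pushforward g c) h)//; last first.
  move=> A mA; apply: (etrans (marginal i mA)); rewrite /gamma_law integral_mkcondr.
  under [RHS]eq_integral do rewrite /h EFinM.
  rewrite ge0_integralZl ?lee_fin//.
  - congr (_ * _)%E; apply: eq_integral => x _.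
    by rewrite !patchE; case: ifP.
  - by apply: measurable_funTS; exact/measurable_EFinP.
  - by move=> x _; rewrite lee_fin.
rewrite [in RHS]integral_mkcond -ge0_integralZl ?lee_fin//.
- apply: eq_integral => x _; rewrite /h !patchE; case: ifP => _.
    by rewrite -!EFinM mulrCA.
  by rewrite !mulr0 -EFinM mulr0 mule0.
- apply/(measurable_restrictT _ (measurable_itv _)).
  apply: measurable_funTS; apply/measurable_EFinP; apply: measurable_funM => //.
  exact: measurable_gamma_integrand.
- move=> x _; rewrite patchE; case: ifP => // _.
  by rewrite lee_fin mulr_ge0// ge0_gamma_integrand.
Qed.

(** Multiplying by x raises the shape parameter by 1, so the moments of the gamma law follow from
    the functional equation [GS]. *)
Let mul_dens r x : 0 < r -> 0 < x -> x * dens r x = dens (r + 1) x.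
Proof. by move=> r0 x0; rewrite mulrA addrK mulr_powRB1// ltW. Qed.

Let GS r : 0 < r -> G (r + 1) = (r%:E * G r)%E.
Proof. exact: Gamma_integralS. Qed.

Let mean_coord i : (\int[g]_z `|z ord0 i|%:E = s%:E)%E.
Proof.
rewrite (integral_coord i (f := fun x => `|x|))//.
have [E n0] := Gamma_fin.
rewrite [X in (_ * X)%E](_ : _ = G (s + 1)).
  by rewrite GS// E -!EFinM mulrCA mulVf ?mulr1.
apply: eq_integral => x; rewrite inE/= in_itv/= andbT => x0.
by rewrite gtr0_norm// mul_dens.
Qed.

Let sq_coord i : (\int[g]_z (`|z ord0 i| * `|z ord0 i|)%:E = (s * (s + 1))%:E)%E.
Proof.
rewrite (integral_coord i (f := fun x => `|x| * `|x|))//; last first.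
  by apply: measurable_funM; exact: normr_measurable.
have [E n0] := Gamma_fin.
rewrite [X in (_ * X)%E](_ : _ = G (s + 1 + 1)).
  rewrite GS ?addr_gt0// GS// E -!EFinM.
  by congr EFin; field.
apply: eq_integral => x; rewrite inE/= in_itv/= andbT => x0.
by rewrite gtr0_norm// -mulrA mul_dens// mul_dens// addr_gt0.
Qed.

Let prod_coord i j : i != j ->
  (\int[g]_z (`|z ord0 i| * `|z ord0 j|)%:E = (s * s)%:E)%E.
Proof.
move=> ij.
have mn k : measurable_fun [set: 'rV[R]_N] (fun z : 'rV[R]_N => `|z ord0 k|).
  by apply: measurableT_comp; [exact: normr_measurable | exact: measurable_coord].
rewrite (@ge0_expectationM_indep _ _ _ g (fun z => `|z ord0 i|) (fun z => `|z ord0 j|))//.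
  by rewrite !mean_coord EFinM.
move=> A B mA mB.
have mn' C : measurable C -> measurable ((fun x : R => `|x|) @^-1` C).
  move=> mC; rewrite -[X in measurable X]setTI.
  exact: normr_measurable.
by have := marginal2 ij (mn' _ mA) (mn' _ mB);
  rewrite -(marginal i (mn' _ mA)) -(marginal j (mn' _ mB)).
Qed.

(** The number c = N s is both the mean and the variance of the sum [A] of the coordinates, and [Q1]
    has mean c (s + 1). The pointwise bound [pw] thus integrates to (4 / c^2) (c (s + 1) + c) = (4 s
    + 8) / c. *)
Lemma gamma_vector_ratio_bound :
  (\int[g]_z (\sum_i (Order.min `|z ord0 i / \sum_j z ord0 j| 1) ^+ 2)%:E
   <= ((4 * s + 8) / (N%:R * s))%:E)%E.
Proof.
set c := N%:R * s; have c0 : 0 < c by rewrite mulr_gt0// ltr0n.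
have mn k : measurable_fun [set: 'rV[R]_N] (fun z : 'rV[R]_N => `|z ord0 k|).
  by apply: measurableT_comp; [exact: normr_measurable | exact: measurable_coord].
pose L (z : 'rV[R]_N) := \sum_i (Order.min `|z ord0 i / \sum_j z ord0 j| 1) ^+ 2.
pose A (z : 'rV[R]_N) := \sum_i `|z ord0 i|.
pose Q (z : 'rV[R]_N) := \sum_i \sum_j (`|z ord0 i| * `|z ord0 j|).
pose Q1 (z : 'rV[R]_N) := \sum_i (`|z ord0 i| * `|z ord0 i|).
pose K := 4 / c ^+ 2.
have K0 : 0 <= K by rewrite divr_ge0 ?exprn_ge0// ltW.
have Kc0 : 0 <= 2 * K * c by exact: mulr_ge0 (mulr_ge0 (ler0n _ 2) K0) (ltW c0).
have L0 z : 0 <= L z by apply: sumr_ge0 => i _; exact: sqr_ge0.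
have A0 z : 0 <= A z by exact: sumr_ge0.
have Q0 z : 0 <= Q z by apply: sumr_ge0 => i _; apply: sumr_ge0 => j _; rewrite mulr_ge0.
have Q10 z : 0 <= Q1 z by apply: sumr_ge0 => i _; rewrite mulr_ge0.
have mA : measurable_fun setT A by exact: measurable_sum.
have mL : measurable_fun setT L.
  by apply: measurable_sum => i; apply: measurable_funX; apply: measurable_min_norm1;
  exact: measurable_ratio.
have mQ : measurable_fun setT Q.
  by apply: measurable_sum => i; apply: measurable_sum => j; exact: measurable_funM.
have mQ1 : measurable_fun setT Q1.
  by apply: measurable_sum => i; exact: measurable_funM.
have QA z : Q z = A z ^+ 2.
  by rewrite /Q /A expr2 mulr_suml; apply: eq_bigr => i _; rewrite mulr_sumr.
have EA : (\int[g]_z (A z)%:E = c%:E)%E.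
  rewrite ge0_integral_sumr; [|exact: mn|by []].
  under eq_bigr do rewrite mean_coord.
  by rewrite sumEFin sumr_const card_ord -mulr_natl.
have EQ1 : (\int[g]_z (Q1 z)%:E = (c * (s + 1))%:E)%E.
  rewrite ge0_integral_sumr; last 2 first.
  - by move=> i; exact: measurable_funM.
  - by move=> i z; rewrite mulr_ge0.
  under eq_bigr do rewrite sq_coord.
  by rewrite sumEFin sumr_const card_ord -mulr_natl mulrA.
have EQ : (\int[g]_z (Q z)%:E = (c ^+ 2 + c)%:E)%E.
  rewrite ge0_integral_sumr; last 2 first.
  - by move=> i; apply: measurable_sum => j; exact: measurable_funM.
  - by move=> i z; apply: sumr_ge0 => j _; rewrite mulr_ge0.
  transitivity (\sum_(i < N) (c * s + s)%:E)%E.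
    apply: eq_bigr => i _; rewrite ge0_integral_sumr; last 2 first.
    - by move=> j; exact: measurable_funM.
    - by move=> j z; rewrite mulr_ge0.
    transitivity (\sum_(j < N) (s * s + (j == i)%:R * s)%:E)%E.
      apply: eq_bigr => j _; case: eqVneq => [->|ji].
        by rewrite sq_coord mulrDr mul1r mulr1.
      by rewrite prod_coord 1?eq_sym// mul0r addr0.
    rewrite sumEFin big_split/= sumr_const card_ord; congr EFin.
    rewrite -mulr_natl mulrA; congr (_ + _).
    rewrite (bigD1 i)//= eqxx mul1r big1 ?addr0// => j /negbTE ->.
    by rewrite mul0r.
  rewrite sumEFin sumr_const card_ord -mulr_natl; congr EFin.
  by rewrite mulrDr mulrCA -/c expr2.
(* If A z >= c / 2 the left-hand sum is at most 4 Q1 z / c^2; otherwise it is at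
   most 1, hence at most 4 (A z - c)^2 / c^2. The cross term of the square is
   moved to the left so that all integrands are nonnegative. *)
have pw : {ae g, forall z, ((L z + (2 * K * c) * A z)%:E <=
    (K * Q1 z + K * Q z + K * c ^+ 2)%:E)%E}.
  apply: filterS gamma_coord_gt0 => z z0; rewrite lee_fin QA.
  have AE : \sum_j z ord0 j = A z by apply: eq_bigr => i _; rewrite gtr0_norm.
  have Az0 : 0 < A z.
    rewrite /A (bigD1 (Ordinal N0))//= ltr_pwDl//; last exact: sumr_ge0.
    by rewrite normr_gt0 gt_eqF.
  rewrite -lerBrDr [leRHS](_ : _ = K * Q1 z + K * (A z - c) ^+ 2); last by ring.
  pose p i := Order.min `|z ord0 i / \sum_j z ord0 j| 1.
  have p0 i : 0 <= p i by rewrite /p le_min normr_ge0 ler01.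
  have p1 i : p i <= 1 by rewrite /p ge_min lexx orbT.
  have pz i : p i <= `|z ord0 i| / A z.
    by rewrite /p ge_min normrM normfV AE (gtr0_norm Az0) lexx.
  have LE : L z = \sum_i p i ^+ 2 by [].
  have [cA|Ac] := leP (c / 2) (A z).
    have AK : (A z ^+ 2)^-1 <= K.
      rewrite /K ler_pdivlMr ?exprn_gt0// mulrC ler_pdivrMr ?exprn_gt0//; nra.
    apply: (@le_trans _ _ (K * Q1 z)); last by rewrite lerDl (mulr_ge0 K0 (sqr_ge0 _)).
    rewrite LE /Q1 mulr_sumr; apply: ler_sum => i _.
    apply: (@le_trans _ _ ((`|z ord0 i| / A z) ^+ 2)).
      by rewrite lerXn2r ?nnegrE// divr_ge0// ltW.
    by rewrite expr_div_n mulrC expr2 ler_wpM2r// mulr_ge0.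
  apply: (@le_trans _ _ (K * (A z - c) ^+ 2)); last by rewrite lerDr mulr_ge0.
  apply: (@le_trans _ _ 1).
    rewrite LE; apply: (@le_trans _ _ (\sum_i `|z ord0 i| / A z)).
      apply: ler_sum => i _; apply: le_trans (pz i).
      by rewrite expr2 ler_piMl.
    by rewrite -mulr_suml divff// gt_eqF.
  rewrite /K mulrAC ler_pdivlMr ?exprn_gt0// mul1r; nra.
have : (\int[g]_z ((L z + (2 * K * c) * A z)%:E) <=
    \int[g]_z (K * Q1 z + K * Q z + K * c ^+ 2)%:E)%E.
  apply: ae_le_integral_measurable => //.
  - by move=> z; rewrite lee_fin; exact: addr_ge0 (L0 z) (mulr_ge0 Kc0 (A0 z)).
  - move=> z; rewrite lee_fin; apply: addr_ge0 (mulr_ge0 K0 (sqr_ge0 _)).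
    exact: addr_ge0 (mulr_ge0 K0 (Q10 z)) (mulr_ge0 K0 (Q0 z)).
  - apply/measurable_EFinP; apply: measurable_funD => //.
    by apply: measurable_funD; exact: measurable_funM.
have mZ (k : R) (f : 'rV[R]_N -> R) : measurable_fun [set: 'rV[R]_N] f ->
    measurable_fun setT (fun z => k * f z).
  by move=> mf; exact: measurable_funM.
have KQ z : 0 <= K * Q z by exact: mulr_ge0.
have KQ1 z : 0 <= K * Q1 z by exact: mulr_ge0.
have KA z : 0 <= 2 * K * c * A z by exact: mulr_ge0.
rewrite ge0_integralDr//; last exact: mZ.
rewrite ge0_integralZlr// EA.
rewrite ge0_integralDr//; last 3 first.
- by apply: measurable_funD; exact: mZ.
- by move=> z; rewrite addr_ge0.
- by move=> _; exact: mulr_ge0 K0 (sqr_ge0 _).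
rewrite ge0_integralDr//; [|exact: mZ|exact: mZ].
rewrite (@ge0_integralZlr _ _ _ g K Q)// (@ge0_integralZlr _ _ _ g K Q1)// EQ EQ1.
rewrite -EFinM integral_cst//.
rewrite [X in (_ <= _ + _ * X)%E -> _](_ : _ = 1%E); last exact: probability_setT.
rewrite mule1 -!EFinM -!EFinD -leeBrDr//.
move=> /le_trans; apply; rewrite -EFinB lee_fin le_eqVlt; apply/orP; left.
by apply/eqP; rewrite /K; field; rewrite gt_eqF.
Qed.

End gamma_vector.

Lemma measurable_simplex d (T : measurableType d) (R : realType) (n : nat)
    (f : 'I_n -> T -> R) : (forall i, measurable_fun [set: T] (f i)) ->
  measurable [set t | (forall i, 0 <= f i t) /\ \sum_i f i t = 1].
Proof.
move=> mf; rewrite (_ : [set t | _] =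
    (\bigcap_(i in [set: 'I_n]) f i @^-1` `[0, +oo[%classic) `&`
    (fun t => \sum_i f i t) @^-1` [set 1]); last first.
  apply/seteqP; split => t -[f0 f1]; split => // i.
    by move=> _; rewrite /= in_itv/= andbT.
  by have := f0 i I; rewrite /= in_itv/= andbT.
apply: measurableI.
  apply: fin_bigcap_measurable => // i _; rewrite -[X in measurable X]setTI.
  exact: (mf i measurableT _ (measurable_itv _)).
rewrite -[X in measurable X]setTI.
by apply: measurable_sum => //; exact: measurable_set1.
Qed.

Section dirichlet.
Context {R : realType} (N : nat) (s : R) (D : probability 'rV[R]_N R).
Hypotheses (N0 : (0 < N)%N) (s0 : 0 < s).
Hypothesis hD : dirichlet_law (fun=> s) D.

Lemma dirichlet_simplex :
  {ae D, forall w : 'rV[R]_N, (forall i, 0 <= w ord0 i) /\ \sum_i w ord0 i = 1}.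
Proof.
have [g gg Dg] := hD.
have mC := @measurable_simplex _ 'rV[R]_N _ _ (fun i w => w ord0 i)
  (@measurable_coord R N).
set C := [set w | _] in mC.
have mC' := measurable_simplex (@measurable_ratio R N).
set C' := [set z | _] in mC'.
exists (~` C); split; first exact: measurableC.
  rewrite (Dg _ (measurableC mC)).
  rewrite (_ : [set z | _] = ~` C'); last first.
    have E (z : 'rV[R]_N) i : ((\sum_i z ord0 i)^-1 *: z) ord0 i = z ord0 i / \sum_j z ord0 j.
      by rewrite mxE mulrC.
    apply/seteqP; split => z; apply: contra_not => -[z0 z1]; split.
    - by move=> i; rewrite /= E.
    - by rewrite /=; under eq_bigr do rewrite E.
    - by move=> i; rewrite /= -E.
    - by rewrite /=; under eq_bigr do rewrite -E.
  apply/negligibleP; first exact: measurableC.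
  suff : {ae g, forall z : 'rV[R]_N, C' z} by exact.
  have gt0 := gamma_coord_gt0 N0 gg.
  apply: filterS gt0 => z z0.
  have A0 : 0 < \sum_j z ord0 j.
    by rewrite (bigD1 (Ordinal N0))//= ltr_pwDl// sumr_ge0// => i _; exact: ltW.
  split; first by move=> i; rewrite divr_ge0// ltW.
  by rewrite -mulr_suml divff// gt_eqF.
by move=> w.
Qed.

(** Ferguson's representation turns the integral into the one for gamma ratios. With s = c / N the
    bound reads 4 / N + 8 / c. *)
Lemma dirichlet_second_moment :
  (\int[D]_w (\sum_i (Order.min `|w ord0 i| 1) ^+ 2)%:E
   <= ((4 * s + 8) / (N%:R * s))%:E)%E.
Proof.
have [g gg Dg] := hD.
apply: le_trans (gamma_vector_ratio_bound N0 s0 gg).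
have mU : measurable_fun [set: 'rV[R]_N]
    (fun w : 'rV[R]_N => \sum_i (Order.min `|w ord0 i| 1) ^+ 2).
  apply: measurable_sum => i; apply: measurable_funX; apply: measurable_min_norm1.
  exact: measurable_coord.
rewrite le_eqVlt; apply/orP; left; apply/eqP.
rewrite -[RHS]mul1e.
apply: (ge0_integral_eq_law (c := 1%:nng)) => //.
- by apply: measurable_sum => i; apply: measurable_funX; apply: measurable_min_norm1;
  exact: measurable_ratio.
- by move=> w; apply: sumr_ge0 => i _; exact: sqr_ge0.
- by move=> w; apply: sumr_ge0 => i _; exact: sqr_ge0.
- move=> B mB; have := mU measurableT B mB; rewrite setTI => mUB.
  rewrite mul1e; apply: (etrans (Dg _ mUB)).
  congr (g _); apply/seteqP; split => z /=.
    by under eq_bigr do rewrite mxE mulrC.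
  by under [X in _ -> B X]eq_bigr do rewrite mxE mulrC.
Qed.

End dirichlet.

(** * Expectations of bounded random variables *)

Section bounded_measurable.
Context d (T : measurableType d) (R : realType) (P : probability T R).
Implicit Types f h : T -> R.

(** The class is closed under sums and products, and on a probability space all its members are
    integrable. Squares of sums can therefore be expanded under real-valued integrals without
    separate integrability arguments. *)
Definition bounded_measurable f :=
  measurable_fun [set: T] f /\ exists M, forall t, `|f t| <= M.

Lemma bounded_measurable_cst (r : R) : bounded_measurable (fun=> r).
Proof. by split; [exact: measurable_cst | exists `|r|]. Qed.

Lemma bounded_measurable_indic G : measurable G -> bounded_measurable \1_G.
Proof.
move=> mG; split; first exact: measurable_indic.
by exists 1 => t; rewrite indicE; case: (_ \in _); rewrite ?normr1 ?normr0.
Qed.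

Lemma bounded_measurableD f h :
  bounded_measurable f -> bounded_measurable h ->
  bounded_measurable (fun t => f t + h t).
Proof.
move=> [mf [M fM]] [mh [K hK]]; split; first exact: measurable_funD.
by exists (M + K) => t; rewrite (le_trans (ler_normD _ _))// lerD.
Qed.

Lemma bounded_measurableM f h :
  bounded_measurable f -> bounded_measurable h ->
  bounded_measurable (fun t => f t * h t).
Proof.
move=> [mf [M fM]] [mh [K hK]]; split; first exact: measurable_funM.
by exists (M * K) => t; rewrite normrM ler_pM.
Qed.

Lemma bounded_measurableZ k f :
  bounded_measurable f -> bounded_measurable (fun t => k * f t).
Proof. by move=> bf; apply: bounded_measurableM => //; exact: bounded_measurable_cst. Qed.

Lemma bounded_measurable_sum (I : Type) (r : seq I) (f : I -> T -> R) :
  (forall i, bounded_measurable (f i)) ->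
  bounded_measurable (fun t => \sum_(i <- r) f i t).
Proof.
move=> bf; elim: r => [|i r ih].
  by under eq_fun do rewrite big_nil; exact: bounded_measurable_cst.
by under eq_fun do rewrite big_cons; exact: bounded_measurableD.
Qed.

Lemma bounded_measurable_integrable f :
  bounded_measurable f -> P.-integrable [set: T] (EFin \o f).
Proof.
move=> [mf [M fM]]; apply: measurable_bounded_integrable => //.
  by apply: fin_num_fun_lty; exact: fin_num_measure.
exists M; split; first exact: num_real.
by move=> x Mx t _; exact: le_trans (fM t) (ltW Mx).
Qed.

Local Notation E f := (\int[P]_t (f t)).

Lemma EFin_Rintegral f : bounded_measurable f ->
  (\int[P]_t (f t)%:E = (E f)%:E)%E.
Proof.
move=> bf; rewrite /Rintegral fineK//; apply: integrable_fin_num => //.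
exact: bounded_measurable_integrable.
Qed.

Lemma Rintegral_cstT (r : R) : E (fun=> r) = r.
Proof. by rewrite Rintegral_cst//= probability_setT mulr1. Qed.

Lemma Rintegral_bmD f h : bounded_measurable f -> bounded_measurable h ->
  E (fun t => f t + h t) = E f + E h.
Proof. by move=> bf bh; rewrite RintegralD//; exact: bounded_measurable_integrable. Qed.

Lemma Rintegral_bmZ k f : bounded_measurable f -> E (fun t => k * f t) = k * E f.
Proof. by move=> bf; rewrite RintegralZl//; exact: bounded_measurable_integrable. Qed.

Lemma Rintegral_bm_sum (I : Type) (r : seq I) (f : I -> T -> R) :
  (forall i, bounded_measurable (f i)) ->
  E (fun t => \sum_(i <- r) f i t) = \sum_(i <- r) E (f i).
Proof.
move=> bf; elim: r => [|i r ih].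
  by rewrite big_nil; under eq_Rintegral do rewrite big_nil; rewrite Rintegral_cstT.
rewrite big_cons -ih -Rintegral_bmD//; last exact: bounded_measurable_sum.
by apply: eq_Rintegral => t _; rewrite big_cons.
Qed.

Lemma Rintegral_bm_le f h : bounded_measurable f -> bounded_measurable h ->
  (forall t, f t <= h t) -> E f <= E h.
Proof.
by move=> bf bh fh; apply: le_Rintegral => //; exact: bounded_measurable_integrable.
Qed.

Lemma Rintegral_indicT G : measurable G -> E \1_G = fine (P G).
Proof. by move=> mG; rewrite /Rintegral integral_indic// setIT. Qed.

End bounded_measurable.

(** The last hypothesis says that, given [G], the law of [U] is that of [f] under [D]. So under [P]
    restricted to [G] the law of [U] is P(G) times that law, and the restriction has density [\1_G]
    with respect to [P]. *)
Lemma Rintegral_indep_indic d (T : measurableType d) (R : realType)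
    (P : probability T R) d2 (T2 : measurableType d2) (D : probability T2 R)
    (G : set T) (U : T -> R) (f : T2 -> R) :
  measurable G -> measurable_fun [set: T] U -> bounded_measurable f ->
  (forall t, 0 <= U t) -> (forall w, 0 <= f w) ->
  (forall B, measurable B -> P (G `&` U @^-1` B) = (P G * D (f @^-1` B))%E) ->
  \int[P]_t (U t * \1_G t) = fine (P G) * \int[D]_w f w.
Proof.
move=> mG mU bf U0 f0 H; have mf := bf.1.
have PG : (fine (P G))%:E = P G by rewrite fineK// fin_num_measure.
have PG0 : 0 <= fine (P G) by exact: fine_ge0.
pose c : {nonneg R} := NngNum PG0.
have E1 : (\int[mrestr P mG]_t (U t)%:E = c%:num%:E * \int[D]_w (f w)%:E)%E.
  apply: ge0_integral_eq_law => // B mB.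
  by apply: (etrans (congr1 P (setIC _ _))); rewrite H//= PG.
have E2 : (\int[mrestr P mG]_t (U t)%:E = \int[P]_t ((U t)%:E * (\1_G t)%:E))%E.
  apply: (ge0_integral_density (h := \1_G)).
  - by move=> t; rewrite indicE.
  - exact: measurable_indic.
  - by move=> A mA; rewrite integral_indic//; exact: (congr1 P (setIC _ _)).
  - by move=> t; rewrite lee_fin.
  - exact/measurable_EFinP.
rewrite /Rintegral; under eq_integral do rewrite EFinM.
by rewrite -E2 E1 EFin_Rintegral// -EFinM.
Qed.

(** * Frequencies under the posterior approximation *)

Section weighted_frequencies.
Context {R : realType} {d n : nat} {dT : measure_display} {T : measurableType dT}.
Local Notation E := 'rV[R]_d.
Context (P : probability T R) (X : 'I_n -> T -> E) (c : R)
  (Q : T -> {measure set E -> \bar R}) (N : nat)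
  (Y : nat -> {mfun T >-> E}) (J : nat -> {mfun T >-> R}).
Hypotheses (N0 : (0 < N)%N) (c0 : 0 < c).
Hypothesis hYJ : DP_approx_draws P X c Q N (fun i => Y i) (fun i => J i).
Hypothesis Q1 : forall t, Q t setT = 1%E.

(* The weights are almost surely in [0, 1]; clamping makes them bounded
   everywhere. *)
Local Notation cl x := (Order.min `|x| 1).

Let mYpre (B : 'I_N -> set E) : (forall i, measurable (B i)) ->
  measurable [set t | forall i : 'I_N, B i (Y i t)].
Proof.
move=> mB; rewrite (_ : [set t | _] = \bigcap_(i in [set: 'I_N]) (Y i @^-1` B i)).
  apply: fin_bigcap_measurable => // i _; rewrite -[X in measurable X]setTI.
  exact: (measurable_funP (Y i) measurableT _ (mB i)).
by apply/seteqP; split => t tB i; [move=> _; exact: tB | exact: tB i I].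
Qed.

(** Conditioning on the whole space averages over the data. The weights remain independent of the
    atoms, while the atoms become a mixture over t of i.i.d. samples from [Q t]. *)
Let law_YJ : exists2 D : probability 'rV[R]_N R,
  dirichlet_law (fun=> c / N%:R) D &
  forall (B : 'I_N -> set E) (C : set 'rV[R]_N),
    (forall i, measurable (B i)) -> measurable C ->
    P ([set t | forall i : 'I_N, B i (Y i t)] `&` [set t | C (\row_(i < N) J i t)])
    = (D C * \int[P]_t (\prod_(i < N) Q t (B i)))%E.
Proof.
have [D hD H] := hYJ; exists D => // B C mB mC.
rewrite -(H setT)// ?setTI//.
exact: (@measurableT _ (g_sigma_algebraType _)).
Qed.

Let law_Y (B : 'I_N -> set E) : (forall i, measurable (B i)) ->
  P [set t | forall i : 'I_N, B i (Y i t)] = (\int[P]_t (\prod_(i < N) Q t (B i)))%E.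
Proof.
move=> mB; have [D _ H] := law_YJ.
by have := H B setT mB measurableT; rewrite probability_setT mul1e setIT.
Qed.

Lemma DP_atom_law (i : 'I_N) (A : set E) : measurable A ->
  P (Y i @^-1` A) = (\int[P]_t Q t A)%E.
Proof.
move=> mA; pose B k := if k == i then A else setT.
have mB k : measurable (B k) by rewrite /B; case: ifP.
rewrite (_ : Y i @^-1` A = [set t | forall k : 'I_N, B k (Y k t)]); last first.
  apply/seteqP; split => t /= => [At k|/(_ i)]; last by rewrite /B eqxx.
  by rewrite /B; case: eqP => [->|].
rewrite law_Y//; apply: eq_integral => t _.
by rewrite (bigD1 i)//= /B eqxx big1 ?mule1// => k /negbTE ->.
Qed.

(** Two atoms are independent only given the data, so the value is E[Q(A)^2] and not (E[Q(A)])^2.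
    Through this the error of the base measure enters the cross terms. *)
Let pair_law (i j : 'I_N) (A : set E) : i != j -> measurable A ->
  P (Y i @^-1` A `&` Y j @^-1` A) = (\int[P]_t (Q t A * Q t A))%E.
Proof.
move=> ij mA; pose B k := if (k == i) || (k == j) then A else setT.
have mB k : measurable (B k) by rewrite /B; case: ifP.
rewrite (_ : _ `&` _ = [set t | forall k : 'I_N, B k (Y k t)]); last first.
  apply/seteqP; split => t /=.
    by move=> [Ai Aj] k; rewrite /B; case: eqP => [->//|_]; case: eqP => [->|].
  by move=> H; split; [have := H i|have := H j]; rewrite /B eqxx ?orbT.
rewrite law_Y//; apply: eq_integral => t _.
rewrite (bigD1 i)//= (bigD1 j) 1?eq_sym//= /B !eqxx orbT /=.
by rewrite big1 ?mule1// => k /andP[/negbTE -> /negbTE ->].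
Qed.

Lemma DP_weights_simplex :
  {ae P, forall t, (forall i : 'I_N, 0 <= J i t) /\ \sum_(i < N) J i t = 1}.
Proof.
have [D hD H] := law_YJ.
have s0 : 0 < c / N%:R by rewrite divr_gt0 ?ltr0n.
have mC := @measurable_simplex _ 'rV[R]_N _ _ (fun i w => w ord0 i)
  (@measurable_coord R N).
have mJ := @measurable_simplex _ T R N (fun i => J i)
  (fun i => measurable_funP (J i)).
set C := [set w | _] in mC; set CJ := [set t | _] in mJ.
have C0 : D (~` C) = 0%E.
  apply/negligibleP; first exact: measurableC.
  exact: (dirichlet_simplex N0 hD).
exists (~` CJ); split => //; first exact: measurableC.
have := H (fun=> setT) _ (fun=> measurableT) (measurableC mC).
rewrite C0 mul0e => <-; congr (P _); apply/seteqP; split => t /=.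
  move=> nJ; split => //; apply: contra_not nJ => -[w0 w1]; split.
    by move=> i; have := w0 i; rewrite mxE.
  by move: w1; under eq_bigr do rewrite mxE.
move=> [_]; apply: contra_not => -[w0 w1]; split.
  by move=> i; rewrite mxE.
by under eq_bigr do rewrite mxE.
Qed.

Section frequency.
Variables (A : set E) (q : T -> R) (theta : R).
Hypotheses (mA : measurable A) (bq : bounded_measurable q).
Hypothesis qE : forall t, Q t A = (q t)%:E.
Hypotheses (th0 : 0 <= theta) (th1 : theta <= 1).

Let xi i t : R := \1_(Y i @^-1` A) t - theta.
Let W i j t := cl (J i t) * cl (J j t).

Let mYA (i : nat) : measurable (Y i @^-1` A).
Proof. by rewrite -[X in measurable X]setTI; exact: measurable_funP. Qed.

Let bcl (i : nat) : bounded_measurable (fun t => cl (J i t)).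
Proof.
split; first by apply: measurable_min_norm1; exact: measurable_funP.
by exists 1 => t; rewrite ger0_norm ?le_min ?normr_ge0 ?ler01// ge_min lexx orbT.
Qed.

Let bW i j : bounded_measurable (W i j).
Proof. exact: bounded_measurableM. Qed.

Let bxi i : bounded_measurable (xi i).
Proof.
apply: bounded_measurableD; first exact: bounded_measurable_indic.
exact: bounded_measurable_cst.
Qed.

Let W0 i j t : 0 <= W i j t.
Proof. by rewrite mulr_ge0// le_min normr_ge0 ler01. Qed.

(** In the expanded square, independence of weights and atoms turns each off-diagonal term into
    [m i j] times v = E[(q - theta)^2], and the [m i j] add up to at most 1 because the weights sum
    to 1. A diagonal term is at most [m i i] since |xi| <= 1, and these add up to the second moment
    of the Dirichlet weights. *)
Lemma weighted_frequency_bound :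
  \int[P]_t ((\sum_(i < N) cl (J i t) * xi i t) ^+ 2) <=
  \int[P]_t ((q t - theta) ^+ 2) + (4 * (c / N%:R) + 8) / c.
Proof.
have [D hD H] := law_YJ.
have s0 : 0 < c / N%:R by rewrite divr_gt0 ?ltr0n.
pose f (i j : 'I_N) (w : 'rV[R]_N) := cl (w ord0 i) * cl (w ord0 j).
have bclD (i : 'I_N) : bounded_measurable (fun w : 'rV[R]_N => cl (w ord0 i)).
  split; first by apply: measurable_min_norm1; exact: measurable_coord.
  by exists 1 => t; rewrite ger0_norm ?le_min ?normr_ge0 ?ler01// ge_min lexx orbT.
have bf i j : bounded_measurable (f i j) by exact: bounded_measurableM.
have f0 i j w : 0 <= f i j w by rewrite mulr_ge0// le_min normr_ge0 ler01.
pose m i j := \int[D]_w f i j w.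
have m0 i j : 0 <= m i j by exact: Rintegral_ge0.
pose v := \int[P]_t ((q t - theta) ^+ 2).
have v0 : 0 <= v by apply: Rintegral_ge0 => t _; exact: sqr_ge0.
have WG (i j : 'I_N) (B : 'I_N -> set E) : (forall k, measurable (B k)) ->
    let G := [set t | forall k : 'I_N, B k (Y k t)] in
    \int[P]_t (W i j t * \1_G t) = fine (P G) * m i j.
  move=> mB G; apply: Rintegral_indep_indic => //.
  - exact: mYpre.
  - exact: (bW i j).1.
  - move=> U mU; have := (bf i j).1 measurableT U mU; rewrite setTI => mfU.
    have := H B _ mB mfU; rewrite -law_Y// muleC => <-; congr (P _).
    by apply/seteqP; split => t /= [Gt]; rewrite /W /f !mxE.
have W1 (i j : 'I_N) : \int[P]_t (W i j t) = m i j.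
  have := WG i j (fun=> setT) (fun=> measurableT) => /=.
  rewrite (_ : [set t | _] = setT); last by apply/seteqP; split.
  rewrite probability_setT mul1r => <-; apply: eq_Rintegral => t _.
  by rewrite indicT mulr1.
have WY (i j k : 'I_N) : \int[P]_t (W i j t * \1_(Y k @^-1` A) t) =
    \int[P]_t (q t) * m i j.
  pose B l := if l == k then A else setT.
  have mB l : measurable (B l) by rewrite /B; case: ifP.
  have -> : Y k @^-1` A = [set t | forall l : 'I_N, B l (Y l t)].
    apply/seteqP; split => t /= => [At l|/(_ k)]; last by rewrite /B eqxx.
    by rewrite /B; case: eqP => [->|].
  rewrite WG//; congr (_ * _).
  rewrite (_ : [set t | _] = Y k @^-1` A); last first.
    apply/seteqP; split => t /= => [/(_ k)|At l]; first by rewrite /B eqxx.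
    by rewrite /B; case: eqP => [->|].
  by rewrite DP_atom_law//; congr fine; apply: eq_integral => t _; rewrite qE.
have WYY (i j : 'I_N) : i != j ->
    \int[P]_t (W i j t * \1_(Y i @^-1` A `&` Y j @^-1` A) t) =
    \int[P]_t (q t * q t) * m i j.
  move=> ij; pose B l := if (l == i) || (l == j) then A else setT.
  have mB l : measurable (B l) by rewrite /B; case: ifP.
  have BE : Y i @^-1` A `&` Y j @^-1` A = [set t | forall l : 'I_N, B l (Y l t)].
    apply/seteqP; split => t /=.
      by move=> [Ai Aj] k; rewrite /B; case: eqP => [->//|_]; case: eqP => [->|].
    by move=> BY; split; [have := BY i|have := BY j]; rewrite /B eqxx ?orbT.
  rewrite BE WG// -BE pair_law//; congr (_ * _); congr fine.
  by apply: eq_integral => t _; rewrite qE -EFinM.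
have vE : v = \int[P]_t (q t * q t) + (- 2 * theta) * \int[P]_t (q t) + theta ^+ 2.
  rewrite -[theta ^+ 2 in RHS](Rintegral_cstT P) -Rintegral_bmZ// -!Rintegral_bmD//.
  - by apply: eq_Rintegral => t _; ring.
  - by apply: bounded_measurableD; [exact: bounded_measurableM|exact: bounded_measurableZ].
  - exact: bounded_measurable_cst.
  - exact: bounded_measurableM.
  - exact: bounded_measurableZ.
have off (i j : 'I_N) : i != j ->
    \int[P]_t (W i j t * (xi i t * xi j t)) = v * m i j.
  move=> ij.
  have bI G : measurable G -> bounded_measurable (fun t => W i j t * \1_G t).
    by move=> mG; apply: bounded_measurableM => //; exact: bounded_measurable_indic.
  transitivity (\int[P]_t (W i j t * \1_(Y i @^-1` A `&` Y j @^-1` A) t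
      + (- theta * (W i j t * \1_(Y i @^-1` A) t)
      + (- theta * (W i j t * \1_(Y j @^-1` A) t)
      + theta ^+ 2 * W i j t)))).
    by apply: eq_Rintegral => t _; rewrite indicI /xi /=; ring.
  have bI1 := bI _ (mYA i); have bI2 := bI _ (mYA j).
  have bI3 := bI _ (measurableI _ _ (mYA i) (mYA j)).
  have bZ1 := bounded_measurableZ (- theta) bI1.
  have bZ2 := bounded_measurableZ (- theta) bI2.
  have bZ3 := bounded_measurableZ (theta ^+ 2) (bW i j).
  have bD2 := bounded_measurableD bZ2 bZ3.
  rewrite (Rintegral_bmD _ bI3 (bounded_measurableD bZ1 bD2)).
  rewrite (Rintegral_bmD _ bZ1 bD2) (Rintegral_bmD _ bZ2 bZ3).
  by rewrite !Rintegral_bmZ// WYY// !WY W1 vE; ring.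
have diag (i : 'I_N) : \int[P]_t (W i i t * (xi i t * xi i t)) <= m i i.
  rewrite -W1; apply: Rintegral_bm_le => //.
    by apply: bounded_measurableM => //; exact: bounded_measurableM.
  move=> t; rewrite ler_piMr//.
  have h : 0 <= theta * (1 - theta) by rewrite mulr_ge0// subr_ge0.
  have [h0 h1] := (th0, th1).
  by rewrite /xi indicE; case: (_ \in _); rewrite /= ?mulr0n ?mulr1n; nra.
have sumE : \int[P]_t ((\sum_(i < N) cl (J i t) * xi i t) ^+ 2) =
    \sum_(i < N) \sum_(j < N) \int[P]_t (W i j t * (xi i t * xi j t)).
  have bWxi (i j : 'I_N) : bounded_measurable (fun t => W i j t * (xi i t * xi j t)).
    by apply: bounded_measurableM => //; exact: bounded_measurableM.
  transitivity (\int[P]_t (\sum_(i < N) \sum_(j < N) W i j t * (xi i t * xi j t))).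
    apply: eq_Rintegral => t _; rewrite expr2 mulr_suml; apply: eq_bigr => i _.
    by rewrite mulr_sumr; apply: eq_bigr => j _; rewrite /W; ring.
  rewrite Rintegral_bm_sum; last by move=> i; exact: bounded_measurable_sum.
  by apply: eq_bigr => i _; rewrite Rintegral_bm_sum.
have msum : \sum_i \sum_j m i j <= 1.
  have -> : \sum_i \sum_j m i j = \int[D]_w (\sum_i cl (w ord0 i)) ^+ 2.
    transitivity (\int[D]_w (\sum_i \sum_j f i j w)).
      rewrite Rintegral_bm_sum; last by move=> i; exact: bounded_measurable_sum.
      by apply: eq_bigr => i _; rewrite Rintegral_bm_sum.
    apply: eq_Rintegral => w _; rewrite expr2 mulr_suml; apply: eq_bigr => i _.
    by rewrite mulr_sumr.
  have bs : bounded_measurable (fun w : 'rV[R]_N => (\sum_i cl (w ord0 i)) ^+ 2).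
    by apply: bounded_measurableM; exact: bounded_measurable_sum.
  rewrite -lee_fin -EFin_Rintegral//.
  apply: (@le_trans _ _ (\int[D]_w 1%:E)%E); last first.
    by rewrite integral_cst// mul1e probability_le1.
  apply: ae_le_integral_measurable => //.
  - by move=> w; rewrite lee_fin sqr_ge0.
  - apply: filterS (dirichlet_simplex N0 hD) => w [w0 w1].
    rewrite lee_fin expr_le1//; last by apply: sumr_ge0 => i _; rewrite le_min normr_ge0 ler01.
    by rewrite -w1; apply: ler_sum => i _; rewrite ge_min ger0_norm// lexx.
have mdiag : \sum_i m i i <= (4 * (c / N%:R) + 8) / c.
  rewrite -Rintegral_bm_sum//.
  rewrite -lee_fin -EFin_Rintegral; last exact: bounded_measurable_sum.
  have := dirichlet_second_moment N0 s0 hD.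
  have -> : N%:R * (c / N%:R) = c by rewrite mulrCA divff ?mulr1// pnatr_eq0 -lt0n.
  by [].
(* Granting the diagonal an extra nonnegative [v * m i i] completes the double sum, so that v
   factors out. *)
rewrite sumE; apply: (@le_trans _ _ (\sum_i \sum_j (v * m i j + (i == j)%:R * m i j))).
  apply: ler_sum => i _; apply: ler_sum => j _.
  have [<-|ij] := eqVneq i j; last by rewrite off// mul0r addr0.
  by rewrite mul1r (le_trans (diag i))// lerDr mulr_ge0.
under eq_bigr do rewrite big_split/=.
rewrite big_split/= lerD//.
  under eq_bigr do rewrite -mulr_sumr.
  by rewrite -mulr_sumr ler_piMr.
apply: le_trans mdiag; apply: ler_sum => i _.
rewrite (bigD1 i)//= eqxx mul1r big1 ?addr0// => j.
by rewrite eq_sym => /negbTE ->; rewrite mul0r.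
Qed.

End frequency.

End weighted_frequencies.

(** * Frequencies in the sample and in the posterior base measure *)

Section data.
Context {R : realType} {d : nat} {dT : measure_display} {T : measurableType dT}.
Local Notation E := 'rV[R]_d.
Context (P : probability T R) (F : probability E R) (X : nat -> {mfun T >-> E}).
Hypothesis hX : iid P (fun i => X i) F.

Lemma iid_marginal i A : measurable A -> P (X i @^-1` A) = F A.
Proof.
move=> mA; pose B k := if k == i then A else setT.
have mB k : measurable (B k) by rewrite /B; case: ifP.
rewrite (_ : X i @^-1` A = [set t | forall k, (k < i.+1)%N -> B k (X k t)]); last first.
  apply/seteqP; split => t /= => [At k _|/(_ i (ltnSn i))]; last by rewrite /B eqxx.
  by rewrite /B; case: eqP => [->|].
apply: (etrans (hX i.+1 mB)).
rewrite (bigD1 ord_max)//= /B eqxx big1 ?mule1// => k /eqP ki.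
case: eqP => [ki'|_]; last exact: probability_setT.
by exfalso; apply: ki; exact: val_inj.
Qed.

Lemma iid_pair i j A : i != j -> measurable A ->
  P (X i @^-1` A `&` X j @^-1` A) = (F A * F A)%E.
Proof.
move=> ij mA; pose B k := if (k == i) || (k == j) then A else setT.
have mB k : measurable (B k) by rewrite /B; case: ifP.
pose M := (maxn i j).+1.
have iM : (i < M)%N by rewrite ltnS leq_maxl.
have jM : (j < M)%N by rewrite ltnS leq_maxr.
rewrite (_ : _ `&` _ = [set t | forall k, (k < M)%N -> B k (X k t)]); last first.
  apply/seteqP; split => t /=.
    by move=> [Ai Aj] k _; rewrite /B; case: eqP => [->//|_]; case: eqP => [->|].
  by move=> BX; split; [have := BX i iM|have := BX j jM]; rewrite /B eqxx ?orbT.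
apply: (etrans (hX M mB)).
rewrite (bigD1 (Ordinal iM))//= (bigD1 (Ordinal jM))/=; last first.
  by apply/eqP => -[] /esym /eqP; rewrite (negbTE ij).
rewrite /B !eqxx orbT /= big1 ?mule1// => k /andP[/eqP ki /eqP kj].
case: eqP => [ki'|_]; first by exfalso; apply: ki; exact: val_inj.
case: eqP => [kj'|_]; first by exfalso; apply: kj; exact: val_inj.
exact: probability_setT.
Qed.

Section frequency.
Variable A : set E.
Hypothesis mA : measurable A.
Let theta := fine (F A).

Let thetaE : theta%:E = F A.
Proof. by rewrite fineK// fin_num_measure. Qed.

Let th01 : 0 <= theta <= 1.
Proof. by rewrite -!lee_fin thetaE measure_ge0 probability_le1. Qed.

Let mXA i : measurable (X i @^-1` A).
Proof. by rewrite -[X in measurable X]setTI; exact: measurable_funP. Qed.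

Let eta i t : R := \1_(X i @^-1` A) t - theta.

Let beta i : bounded_measurable (eta i).
Proof.
apply: bounded_measurableD; first exact: bounded_measurable_indic.
exact: bounded_measurable_cst.
Qed.

(** The centred indicators [eta i] are orthogonal in L2 by pairwise independence. Only the n
    diagonal terms remain, each at most 1. *)
Lemma empirical_frequency_bound n :
  \int[P]_t ((\sum_(i < n) eta i t) ^+ 2) <= n%:R.
Proof.
have bee i j : bounded_measurable (fun t => eta i t * eta j t).
  exact: bounded_measurableM.
have -> : \int[P]_t ((\sum_(i < n) eta i t) ^+ 2) =
    \sum_(i < n) \sum_(j < n) \int[P]_t (eta i t * eta j t).
  transitivity (\int[P]_t (\sum_(i < n) \sum_(j < n) eta i t * eta j t)).
    apply: eq_Rintegral => t _; rewrite expr2 mulr_suml; apply: eq_bigr => i _.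
    by rewrite mulr_sumr.
  rewrite Rintegral_bm_sum; last by move=> i; exact: bounded_measurable_sum.
  by apply: eq_bigr => i _; rewrite Rintegral_bm_sum.
have off (i j : 'I_n) : i != j -> \int[P]_t (eta i t * eta j t) = 0.
  move=> ij; have bI G : measurable G -> bounded_measurable (\1_G : T -> R).
    exact: bounded_measurable_indic.
  have bI1 := bounded_measurableZ (- theta) (bI _ (mXA i)).
  have bI2 := bounded_measurableZ (- theta) (bI _ (mXA j)).
  have bI3 := bI _ (measurableI _ _ (mXA i) (mXA j)).
  have bc := @bounded_measurable_cst _ T R (theta ^+ 2).
  transitivity (\int[P]_t (\1_(X i @^-1` A `&` X j @^-1` A) t
      + (- theta * \1_(X i @^-1` A) t + (- theta * \1_(X j @^-1` A) t + theta ^+ 2)))).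
    by apply: eq_Rintegral => t _; rewrite indicI /eta /=; ring.
  have bD2 := bounded_measurableD bI2 bc.
  rewrite (Rintegral_bmD _ bI3 (bounded_measurableD bI1 bD2)).
  rewrite (Rintegral_bmD _ bI1 bD2) (Rintegral_bmD _ bI2 bc).
  rewrite (Rintegral_bmZ _ _ (bI _ (mXA i))) (Rintegral_bmZ _ _ (bI _ (mXA j))).
  rewrite Rintegral_cstT !Rintegral_indicT//; last exact: measurableI.
  rewrite iid_pair// !iid_marginal// -thetaE -EFinM /=; ring.
have diag (i : 'I_n) : \int[P]_t (eta i t * eta i t) <= 1.
  rewrite -[leRHS](Rintegral_cstT P); apply: Rintegral_bm_le => //.
    exact: bounded_measurable_cst.
  move=> t; have /andP[h0 h1] := th01.
  have h : 0 <= theta * (1 - theta) by rewrite mulr_ge0// subr_ge0.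
  by rewrite /eta indicE; case: (_ \in _); rewrite /= ?mulr0n ?mulr1n; nra.
rewrite -[leRHS]mulr1 mulr_natl -[in leRHS](card_ord n) -sumr_const.
apply: ler_sum => i _; rewrite (bigD1 i)//= big1 ?addr0//.
by move=> j ji; rewrite off// eq_sym.
Qed.

Variables (a : {posnum R}) (H : probability E R) (n : nat).
Hypothesis n0 : (0 < n)%N.

(** The mass H^*(A) as a real random variable: the n in the mixing weight n / (a + n) has cancelled
    the 1 / n of the empirical measure. *)
Definition post_frequency t : R :=
  a%:num / (a%:num + n%:R) * fine (H A)
  + (a%:num + n%:R)^-1 * \sum_(i < n) \1_(X i @^-1` A) t.

Lemma post_base_frequency t :
  post_base a H (X ^~ t) n A = (post_frequency t)%:E.
Proof.
set c := a%:num + n%:R.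
transitivity ((a%:num / c)%:E * H A +
    (n%:R / c)%:E * ((n%:R^-1)%:E * \sum_(k < n) \d_(X k t) A))%E.
  exact: measure_addE.
have nR : 0 < n%:R :> R by rewrite ltr0n.
have c0 : 0 < c by rewrite addr_gt0.
under eq_bigr do rewrite diracE.
rewrite sumEFin -(fineK (fin_num_measure H A mA)) -!EFinM -EFinD; congr EFin.
rewrite /post_frequency -/c mulrA; congr (_ + _ * _).
by rewrite mulrAC divff ?mul1r// gt_eqF.
Qed.

Lemma bounded_measurable_post_frequency : bounded_measurable post_frequency.
Proof.
apply: bounded_measurableD; first exact: bounded_measurable_cst.
apply: bounded_measurableZ; apply: bounded_measurable_sum => i.
exact: bounded_measurable_indic.
Qed.

(** Bias and fluctuation are separated: H^*(A) - F(A) is a / (a + n) times H(A) - F(A), plus the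
    centred count divided by a + n. Then (x + y)^2 <= 2 x^2 + 2 y^2. *)
Lemma post_frequency_bound :
  \int[P]_t ((post_frequency t - theta) ^+ 2) <=
  2 * (a%:num / n%:R) ^+ 2 + 2 / n%:R.
Proof.
set c := a%:num + n%:R.
have nR : 0 < n%:R :> R by rewrite ltr0n.
have a0 : 0 < a%:num by [].
have c0 : 0 < c by rewrite addr_gt0.
have bS : bounded_measurable (fun t => (\sum_(i < n) eta i t) ^+ 2).
  by apply: bounded_measurableM; exact: bounded_measurable_sum.
have pfE t : post_frequency t - theta =
    a%:num / c * (fine (H A) - theta) + c^-1 * \sum_(i < n) eta i t.
  rewrite /post_frequency /eta big_split/= sumr_const card_ord -mulr_natl -/c.
  by rewrite /c; field; rewrite gt_eqF.
have h01 : 0 <= fine (H A) <= 1.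
  by rewrite -!lee_fin fineK ?fin_num_measure// measure_ge0 probability_le1.
apply: (@le_trans _ _ (\int[P]_t (2 * (a%:num / c) ^+ 2 +
    2 / c ^+ 2 * (\sum_(i < n) eta i t) ^+ 2))).
  apply: Rintegral_bm_le.
  - have b : bounded_measurable (fun t => post_frequency t - theta).
      apply: bounded_measurableD; first exact: bounded_measurable_post_frequency.
      exact: bounded_measurable_cst.
    exact: bounded_measurableM.
  - apply: bounded_measurableD; first exact: bounded_measurable_cst.
    exact: bounded_measurableZ.
  - move=> t; rewrite pfE.
    set x := a%:num / c; set y := \sum_(i < n) eta i t; set h := fine (H A) - theta.
    have hh : h ^+ 2 <= 1.
      have /andP[? ?] := th01; have /andP[? ?] := h01.
      rewrite -real_normK ?num_real// expr_le1// ler_norml /h; apply/andP; split; lra.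
    have xh : (x * h) ^+ 2 <= x ^+ 2 by rewrite exprMn ler_piMr// sqr_ge0.
    have -> : 2 / c ^+ 2 * y ^+ 2 = 2 * (c^-1 * y) ^+ 2.
      by field; rewrite gt_eqF.
    have := sqr_ge0 (x * h - c^-1 * y); nra.
rewrite Rintegral_bmD; [|exact: bounded_measurable_cst|exact: bounded_measurableZ].
rewrite Rintegral_cstT Rintegral_bmZ//.
have nc : n%:R <= c by rewrite /c lerDr.
apply: lerD.
  rewrite ler_pM2l// lerXn2r ?nnegrE ?divr_ge0 ?(ltW c0) ?(ltW nR)//.
  by rewrite ler_pM2l// lef_pV2 ?posrE.
apply: (@le_trans _ _ (2 / c ^+ 2 * n%:R)).
  by rewrite ler_wpM2l ?empirical_frequency_bound// divr_ge0// sqr_ge0.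
rewrite ler_pdivlMr// [leLHS](_ : _ = 2 * (n%:R / c) ^+ 2); last first.
  by field; rewrite gt_eqF.
have nc0 : 0 <= n%:R / c by rewrite divr_ge0// ltW.
by rewrite ler_piMr// expr_le1// ler_pdivrMr// mul1r.
Qed.

End frequency.
End data.

(** * Wasserstein distance and kernel mean embeddings *)

Lemma rV_open_measurable (R : realType) (n : nat) (A : set 'rV[R]_n) :
  open A -> measurable A.
Proof. exact: sub_sigma_algebra. Qed.

Lemma rV_compact_measurable (R : realType) (n : nat) (S : set 'rV[R]_n) :
  compact S -> measurable S.
Proof.
move=> cS; rewrite -[S]setCK; apply: measurableC; apply: rV_open_measurable.
by apply: closed_openC; apply: compact_closed => //; exact: norm_hausdorff.
Qed.

Lemma within_continuous_rV_measurable (R : realType) (n : nat)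
    (S : set 'rV[R]_n) (f : 'rV[R]_n -> R) :
  measurable S -> {within S, continuous f} -> measurable_fun S f.
Proof.
move=> mS /continuousP cf mS'.
apply: (measurability _ (RGenOpens.measurableE R)) => // _ [_ [a [b ->]] <-].
have oab : open `]a, b[%classic by exact: interval_open.
have /open_subspaceP[V oV VE] := cf _ oab.
rewrite setIC -VE; apply: measurableI => //; exact: rV_open_measurable.
Qed.

Lemma integrable_within_continuous (R : realType) (n : nat)
    (S : set 'rV[R]_n) (f : 'rV[R]_n -> R) (mu : {measure set 'rV[R]_n -> \bar R}) :
  compact S -> (mu S < +oo)%E -> {within S, continuous f} ->
  mu.-integrable S (EFin \o f).
Proof.
move=> cS muS cf; have mS := rV_compact_measurable cS.
apply: measurable_bounded_integrable => //.
  exact: within_continuous_rV_measurable.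
have /compact_bounded[M [Mr hM]] := continuous_compact cf cS.
exists M; split => // x Mx y Sy; apply: (hM x Mx); exact: imageP.
Qed.

(** A finite subcover is made disjoint by removing from each piece the earlier ones. A piece may
    thus be empty or miss its own point [p i]. *)
Lemma compact_partition (R : realType) (n : nat) (S : set 'rV[R]_n)
    (U : 'rV[R]_n -> set 'rV[R]_n) :
  compact S -> (forall x, S x -> open (U x)) -> (forall x, S x -> U x x) ->
  exists m (A : 'I_m -> set 'rV[R]_n) (p : 'I_m -> 'rV[R]_n),
  [/\ forall i, measurable (A i), trivIset [set: 'I_m] A,
      \big[setU/set0]_(i < m) A i = S, forall i, S (p i) &
      forall i, A i `<=` U (p i)].
Proof.
move=> cS oU UU; have mS := rV_compact_measurable cS.
have := cS; rewrite compact_cover => /(_ _ S U oU) [].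
  by move=> x Sx; exists x => //; exact: UU.
move=> D DS; have /finite_seqP[s sE] := finite_fset D; rewrite sE => SD.
have Ss i : (i < size s)%N -> S (nth 0 s i).
  move=> /(mem_nth 0) si; have : [set` s] (nth 0 s i) by [].
  by rewrite -sE => /DS /set_mem.
pose B i := if (i < size s)%N then S `&` U (nth 0 s i) else set0.
have mB i : measurable (B i).
  rewrite /B; case: ifP => // si; apply: measurableI => //.
  by apply: rV_open_measurable; apply: oU; exact: Ss.
exists (size s), (fun i => seqDU B i), (fun i => nth 0 s i); split.
- move=> i; rewrite /seqDU; apply: measurableD => //.
  exact: bigsetU_measurable.
- apply/trivIsetP => i j _ _ ij.
  by have /trivIsetP := trivIset_seqDU B; apply.
- rewrite -bigsetU_seqDU; apply/seteqP; split => x.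
    rewrite -bigcup_mkord => -[i _]; rewrite /B.
    by case: ifP => // _ [].
  move=> Sx; have [y yD Uy] := SD x Sx.
  rewrite -bigcup_mkord; exists (index y s) => /=; rewrite ?index_mem//.
  by rewrite /B index_mem ifT// nth_index.
- by move=> i; exact: Ss.
- by move=> i x; rewrite /seqDU /B ltn_ord => -[[]].
Qed.

Section partition.
Context (R : realType) (n m : nat) (S : set 'rV[R]_n) (A : 'I_m -> set 'rV[R]_n).
Hypotheses (mA : forall i, measurable (A i)) (tA : trivIset [set: 'I_m] A).
Hypothesis AS : \big[setU/set0]_(i < m) A i = S.
Implicit Type mu : {measure set 'rV[R]_n -> \bar R}.

Let subA i : A i `<=` S.
Proof. by move=> x Ax; rewrite -AS (bigD1 i)//=; left. Qed.

Let mS : measurable S.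
Proof. by rewrite -AS; exact: bigsetU_measurable. Qed.

Lemma partition_fin mu i : mu S = 1%E -> (fine (mu (A i)))%:E = mu (A i).
Proof.
move=> muS; rewrite fineK// ge0_fin_numE//.
by apply: (@le_lt_trans _ _ (mu S)); [apply: le_measure; rewrite ?inE | rewrite muS ltry].
Qed.

Lemma partition_mass mu : mu S = 1%E -> \sum_i fine (mu (A i)) = 1.
Proof.
move=> muS; apply/EFin_inj; rewrite -sumEFin -muS -AS measure_bigsetU_ord//.
by apply: eq_bigr => i _; exact: partition_fin.
Qed.

(** Each piece contributes an error of at most e times its mass, and the masses add up to 1. *)
Lemma partition_approx mu (f : 'rV[R]_n -> R) (p : 'I_m -> 'rV[R]_n) (e : R) :
  mu S = 1%E -> mu.-integrable S (EFin \o f) ->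
  (forall i x, A i x -> `|f x - f (p i)| <= e) ->
  `|\int[mu]_(x in S) f x - \sum_i f (p i) * fine (mu (A i))| <= e.
Proof.
move=> muS intf fe.
have intA i : mu.-integrable (A i) (EFin \o f) by exact: (integrableS mS).
have muA i : (mu (A i) < +oo)%E by rewrite -partition_fin// ltry.
have intc i (c : R) : mu.-integrable (A i) (EFin \o (fun=> c)).
  by apply: measurable_bounded_integrable => //; exact: bounded_cst.
have -> : \int[mu]_(x in S) f x = \sum_i \int[mu]_(x in A i) f x.
  rewrite /Rintegral -[in LHS]AS integral_bigsetU_EFin//; last 3 first.
  - exact: index_enum_uniq.
  - exact: sub_trivIset tA.
  - by rewrite AS; exact: measurable_int intf.
  by rewrite sum_fine// => i _; apply: integrable_fin_num.
rewrite -sumrB (le_trans (ler_norm_sum _ _ _))//.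
apply: (@le_trans _ _ (\sum_i e * fine (mu (A i)))); last first.
  by rewrite -mulr_sumr partition_mass// mulr1.
apply: ler_sum => i _.
rewrite -[f (p i) * _]Rintegral_cst// -(RintegralB (mA i) (intA i) (intc i _)).
apply: (le_trans (le_normr_Rintegral _ _)) => //.
  by apply: (integrableB (mA i) (intA i) (intc i _)).
rewrite -Rintegral_cst//.
apply: (le_Rintegral (mA i) _ (intc i e)); last by move=> x Ax; exact: fe.
by apply: integrable_norm; exact: (integrableB (mA i) (intA i) (intc i _)).
Qed.

End partition.

Section wasserstein.
Context {R : realType} {d : nat}.
Local Notation E := 'rV[R]_d.
Implicit Types (S : set E) (mu nu : {measure set E -> \bar R}).

(** The topology on row vectors comes from the sup norm, so continuity of the Euclidean norm is
    derived from its coordinate formula. *)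
Lemma enorm_continuous : continuous (@enorm R d).
Proof.
move=> x; apply: (@continuous_comp _ _ _ (fun y : E => \sum_i y ord0 i ^+ 2) Num.sqrt).
  elim: (index_enum _) => [|i r ih].
    rewrite (_ : (fun _ => _) = cst 0); last first.
      by apply/funext => y; rewrite big_nil.
    exact: cst_continuous.
  rewrite (_ : (fun _ => _) = (fun y : E => y ord0 i ^+ 2 + \sum_(j <- r) y ord0 j ^+ 2)).
    apply: continuousD ih.
    apply: (@continuous_comp _ _ _ (fun y : E => y ord0 i) (fun r : R => r ^+ 2)).
      exact: coord_continuous.
    exact: exprn_continuous.
  by apply/funext => y; rewrite big_cons.
exact: sqrt_continuous.
Qed.

Lemma enorm0 : enorm (0 : E) = 0.
Proof. by rewrite /enorm big1 ?sqrtr0// => i _; rewrite mxE expr0n. Qed.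

Lemma enorm_ge0 (x : E) : 0 <= enorm x.
Proof. exact: sqrtr_ge0. Qed.

Lemma enorm_ball_open (x : E) (e : R) : open [set y | enorm (y - x) < e].
Proof.
apply: (@open_comp _ _ (fun y : E => enorm (y - x)) [set r | r < e]).
  move=> y _; apply: (@continuous_comp _ _ _ (fun y : E => y - x) (@enorm R d));
    last exact: enorm_continuous.
  by apply: (@continuousB _ _ _ id (cst x)) => //; exact: cst_continuous.
exact: open_lt.
Qed.

Lemma lipschitz1_within_continuous S D : lipschitz1 S D -> {within S, continuous D}.
Proof.
move=> lD; apply/subspace_continuousP => x Sx.
apply/cvgrPdist_lt => e e0; rewrite near_withinE.
have oB := @enorm_ball_open x e.
have : nbhs x [set y | enorm (y - x) < e].
  by apply: open_nbhs_nbhs; split => //; rewrite /= subrr enorm0.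
apply: filterS => y ye Sy; rewrite distrC.
exact: le_lt_trans (lD y x Sy Sx) ye.
Qed.

Lemma W_ge0 S mu nu : (0 <= W S mu nu)%E.
Proof.
apply: ereal_sup_ubound; exists (fun=> 0).
  by move=> x y _ _; rewrite subrr normr0 enorm_ge0.
by rewrite !integral0 subee.
Qed.

(** Test functions are continuous on the compact [S], so the middle integral is finite and cancels.
    Masses are taken finite rather than equal to 1 because a generator law may charge the complement
    of [S]. *)
Lemma W_triangle S mu1 mu2 mu3 : compact S ->
  (mu1 S < +oo)%E -> (mu2 S < +oo)%E -> (mu3 S < +oo)%E ->
  (W S mu1 mu3 <= W S mu1 mu2 + W S mu2 mu3)%E.
Proof.
move=> cS m1 m2 m3; apply: ge_ereal_sup => _ [D lD <-].
have cD := lipschitz1_within_continuous lD.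
have mS := rV_compact_measurable cS.
have fin mu : (mu S < +oo)%E -> (\int[mu]_(x in S) (D x)%:E)%E \is a fin_num.
  by move=> muS; apply: integrable_fin_num => //; exact: integrable_within_continuous.
have le mu nu : (\int[mu]_(x in S) (D x)%:E - \int[nu]_(x in S) (D x)%:E
    <= W S mu nu)%E by apply: ereal_sup_ubound; exists D.
apply: le_trans (leeD (le mu1 mu2) (le mu2 mu3)).
by rewrite addeA subeK ?fin.
Qed.

Lemma W_symmetric S mu nu : compact S -> (mu S < +oo)%E -> (nu S < +oo)%E ->
  (W S mu nu <= W S nu mu)%E.
Proof.
move=> cS m1 m2; apply: ge_ereal_sup => _ [D lD <-].
have cD := lipschitz1_within_continuous lD.
have mS := rV_compact_measurable cS.
have int (m : {measure set E -> \bar R}) : (m S < +oo)%E -> m.-integrable S (EFin \o D).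
  by move=> mS'; exact: integrable_within_continuous.
have N (m : {measure set E -> \bar R}) : (m S < +oo)%E ->
    (\int[m]_(x in S) (- D x)%:E = - \int[m]_(x in S) (D x)%:E)%E.
  move=> mS'; have := integralZl mS (int m mS') (-1); rewrite mulN1e => <-.
  by apply: eq_integral => x _; rewrite mulN1e EFinN.
apply: ereal_sup_ubound; exists (fun x => - D x).
  by move=> x y Sx Sy; rewrite -opprD normrN; exact: lD.
have fin (m : {measure set E -> \bar R}) : (m S < +oo)%E ->
      (\int[m]_(x in S) (D x)%:E)%E \is a fin_num.
  by move=> mS'; apply: integrable_fin_num => //; exact: int.
by rewrite !N// oppeK addeC.
Qed.

(** Both masses are 1, so D can be replaced by D - D(x0), whose absolute value at [p i] is at most
    [enorm (p i - x0)] for every D. This makes the bound uniform over the test functions. *)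
Lemma W_partition_bound S m (A : 'I_m -> set E) (p : 'I_m -> E) (e : R) x0 mu nu :
  compact S -> mu S = 1%E -> nu S = 1%E ->
  (forall i, measurable (A i)) -> trivIset [set: 'I_m] A ->
  \big[setU/set0]_(i < m) A i = S -> (forall i, S (p i)) ->
  (forall i x, A i x -> enorm (x - p i) <= e) -> S x0 ->
  (W S mu nu <= (2 * e + \sum_i enorm (p i - x0) *
     `|fine (mu (A i)) - fine (nu (A i))|)%:E)%E.
Proof.
move=> cS muS nuS mA tA AS Sp Ae Sx0; apply: ge_ereal_sup => _ [D lD <-].
have cD := lipschitz1_within_continuous lD.
have mS := rV_compact_measurable cS.
have int (m' : {measure set E -> \bar R}) : m' S = 1%E -> m'.-integrable S (EFin \o D).
  by move=> mS'; apply: integrable_within_continuous => //; rewrite mS' ltry.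
have fin (m' : {measure set E -> \bar R}) : m' S = 1%E ->
    (\int[m']_(x in S) (D x)%:E = (\int[m']_(x in S) D x)%:E)%E.
  by move=> mS'; rewrite /Rintegral fineK//; apply: integrable_fin_num => //; exact: int.
rewrite !fin// -EFinB lee_fin.
have De i x : A i x -> `|D x - D (p i)| <= e.
  move=> Ax; apply: le_trans (Ae i x Ax); apply: lD => //.
  by rewrite -AS (bigD1 i)//=; left.
have mu1 := partition_approx mA tA AS muS (int _ muS) De.
have nu1 := partition_approx mA tA AS nuS (int _ nuS) De.
have mum := partition_mass mA tA AS muS.
have num := partition_mass mA tA AS nuS.
set s1 := \sum_i _ in mu1; set s2 := \sum_i _ in nu1.
have s12 : s1 - s2 = \sum_i (D (p i) - D x0) * (fine (mu (A i)) - fine (nu (A i))).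
  have : \sum_i D x0 * (fine (mu (A i)) - fine (nu (A i))) = 0.
    by rewrite -mulr_sumr sumrB mum num subrr mulr0.
  move=> H0; rewrite -[LHS]subr0 -[X in _ - X]H0 /s1 /s2 -!sumrB.
  by apply: eq_bigr => i _; ring.
have h3 : s1 - s2 <= \sum_i enorm (p i - x0) * `|fine (mu (A i)) - fine (nu (A i))|.
  rewrite s12; apply: ler_sum => i _; apply: le_trans (ler_norm _) _.
  by rewrite normrM ler_wpM2r// lD.
move: mu1 nu1; rewrite !ler_norml => /andP[_ h1] /andP[h2 _]; lra.
Qed.

End wasserstein.

(** * Feature map and mean embeddings in the reproducing kernel Hilbert space *)

Section rkhs.
Context {R : realType} {d : nat}.
Local Notation E := 'rV[R]_d.
Context (S : set E) (k : E -> E -> R) (Hk : completeNormedModType R)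
  (dot : {dot Hk for idfun}) (ev : Hk -> E -> R).
Hypothesis cS : compact S.
Hypothesis hHk : is_rkhs S k dot ev.
Hypothesis ck : {within S `*` S, continuous (fun xy => k xy.1 xy.2)}.

Let dotP a f g h : dot (a *: f + g) h = a * dot f h + dot g h.
Proof. by rewrite linearPl. Qed.

Let dotC f g : dot f g = dot g f.
Proof. by rewrite hermC expr0 mul1r. Qed.

Let dotn f : dot f f = `|f| ^+ 2.
Proof. by have [] := hHk. Qed.

Let dotDl f g h : dot (f + g) h = dot f h + dot g h.
Proof. by rewrite -[f]scale1r dotP mul1r scale1r. Qed.

Let dot0l h : dot 0 h = 0.
Proof. by apply: (addrI (dot 0 h)); rewrite -dotDl !addr0. Qed.

Let dotZl a f h : dot (a *: f) h = a * dot f h.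
Proof. by rewrite -[a *: f]addr0 dotP dot0l addr0. Qed.

Let dotNl f h : dot (- f) h = - dot f h.
Proof. by rewrite -scaleN1r dotZl mulN1r. Qed.

Let dotDr f g h : dot f (g + h) = dot f g + dot f h.
Proof. by rewrite dotC dotDl !(dotC _ f). Qed.

Let dotNr f h : dot f (- h) = - dot f h.
Proof. by rewrite dotC dotNl dotC. Qed.

Let dotBr f g h : dot f (g - h) = dot f g - dot f h.
Proof. by rewrite dotDr dotNr. Qed.

Let dotZr a f h : dot f (a *: h) = a * dot f h.
Proof. by rewrite dotC dotZl dotC. Qed.

Let dot_sumr (I : Type) (r : seq I) f (g : I -> Hk) :
  dot f (\sum_(i <- r) g i) = \sum_(i <- r) dot f (g i).
Proof.
elim: r => [|i r ih]; first by rewrite !big_nil dotC dot0l.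
by rewrite !big_cons dotDr ih.
Qed.

(* Expanding [`|f + g| <= `|f| + `|g|] shows that a norm given by a bilinear
   form satisfies the Cauchy-Schwarz inequality. *)
Let dot_le_norm f g : dot f g <= `|f| * `|g|.
Proof.
have H : `|f + g| ^+ 2 <= (`|f| + `|g|) ^+ 2.
  by rewrite lerXn2r ?nnegrE ?addr_ge0// ler_normD.
move: H; rewrite -dotn dotDl !dotDr !dotn (dotC g f) sqrrD; lra.
Qed.

Lemma dot_norm_le f g : `|dot f g| <= `|f| * `|g|.
Proof.
rewrite ler_norml dot_le_norm andbT lerNl -dotNr.
by rewrite (le_trans (dot_le_norm _ _))// normrN.
Qed.

(** The representer k(x, .), of which [is_rkhs] asserts only the existence; the default 0 is met
    only outside [S]. *)
Definition feature x : Hk :=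
  xget 0 [set kx | (forall y, S y -> ev kx y = k x y) /\ forall f, dot f kx = ev f x].

Lemma featureP x : S x ->
  (forall y, S y -> ev (feature x) y = k x y) /\ forall f, dot f (feature x) = ev f x.
Proof.
move=> Sx; rewrite /feature; case: xgetP => [_ -> //|H].
have [_ _ _ /(_ x Sx)[kx h1 h2]] := hHk.
by exfalso; exact: (H kx).
Qed.

Let dot_feature f x : S x -> dot f (feature x) = ev f x.
Proof. by move=> /featureP[]. Qed.

Let kC x y : S x -> S y -> k x y = k y x.
Proof.
move=> Sx Sy; have [hx _] := featureP Sx; have [hy _] := featureP Sy.
by rewrite -hx// -hy// -!dot_feature// dotC.
Qed.

Lemma feature_dist x y : S x -> S y ->
  `|feature x - feature y| ^+ 2 = k x x - k x y - (k x y - k y y).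
Proof.
move=> Sx Sy; rewrite -dotn dotBr !(dotDl, dotNl) !dot_feature//.
have [hx _] := featureP Sx; have [hy _] := featureP Sy.
by rewrite !hx ?hy// (kC Sy Sx); ring.
Qed.

Lemma feature_continuous x : S x -> forall e, 0 < e ->
  exists2 V, open V /\ V x & forall y, V y -> S y -> `|feature y - feature x| <= e.
Proof.
move=> Sx e e0.
have /subspace_continuousP/(_ (x, x) (conj Sx Sx)) := ck.
(* The squared feature distance equals 2 (k x x - k x y) - (k x x - k y y), which amounts to three
   small differences. *)
move=> /cvgrPdist_lt/(_ (e ^+ 2 / 3)); rewrite divr_gt0 ?exprn_gt0// => /(_ isT).
rewrite near_withinE => -[[U1 U2] /= [n1 n2] sub].
have : nbhs x (U1 `&` U2) by exact: filterI.
rewrite nbhsE => -[V [oV Vx] VU]; exists V => // y Vy Sy.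
have [y1 y2] := VU _ Vy; have [x1 x2] := VU _ Vx.
have h1 : `|k x x - k x y| < e ^+ 2 / 3 := sub (x, y) (conj x1 y2) (conj Sx Sy).
have h2 : `|k x x - k y y| < e ^+ 2 / 3 := sub (y, y) (conj y1 y2) (conj Sy Sy).
rewrite -(ler_pXn2r (n := 2))// ?nnegrE//; last exact: ltW.
rewrite distrC feature_dist//.
move: h1 h2; rewrite !ltr_norml => /andP[a1 a2] /andP[b1 b2]; lra.
Qed.

Lemma ev_feature_bound f x y : S x -> S y ->
  `|ev f x - ev f y| <= `|f| * `|feature x - feature y|.
Proof.
by move=> Sx Sy; rewrite -!dot_feature// -dotBr dot_norm_le.
Qed.

Lemma ev_within_continuous f : {within S, continuous (ev f)}.
Proof.
apply/subspace_continuousP => x Sx; apply/cvgrPdist_lt => e e0.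
rewrite near_withinE.
have f1 : 0 < `|f| + 1 by rewrite ltr_wpDl.
have e'0 : 0 < e / (`|f| + 1) by rewrite divr_gt0.
have [V [oV Vx] hV] := feature_continuous Sx e'0.
have : nbhs x V by apply: open_nbhs_nbhs.
apply: filterS => y Vy Sy; rewrite distrC.
apply: (le_lt_trans (ev_feature_bound f Sy Sx)).
apply: (@le_lt_trans _ _ (`|f| * (e / (`|f| + 1)))).
  by rewrite ler_wpM2l// hV.
by rewrite mulrCA gtr_pMr// ltr_pdivrMr// mul1r ltrDl.
Qed.

(** Intersecting a Euclidean ball with a neighbourhood on which the feature map varies by at most e
    gives one partition that serves both W and MMD. *)
Lemma feature_partition (e : R) : 0 < e ->
  exists m (A : 'I_m -> set E) (p : 'I_m -> E),
  [/\ forall i, measurable (A i), trivIset [set: 'I_m] A,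
      \big[setU/set0]_(i < m) A i = S, forall i, S (p i) &
      forall i x, A i x ->
        enorm (x - p i) <= e /\ `|feature x - feature (p i)| <= e].
Proof.
move=> e0.
pose Q x V := (open V /\ V x) /\ forall y, V y -> S y -> `|feature y - feature x| <= e.
pose V x := xget setT (Q x).
have VP x : S x -> Q x (V x).
  move=> Sx; rewrite /V; case: xgetP => [_ -> //|H].
  have [W hW1 hW2] := feature_continuous Sx e0.
  by exfalso; exact: (H W).
pose U x := V x `&` [set y | enorm (y - x) < e].
have [x Sx|x Sx|m [A [p [mA tA AS Sp AU]]]] := compact_partition (U := U) cS.
- by apply: openI; [exact: (VP x Sx).1.1 | exact: enorm_ball_open].
- by split; [exact: (VP x Sx).1.2 | rewrite /= subrr enorm0].
exists m, A, p; split => // i x Ax; have [Vx ex] := AU i x Ax.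
split; first exact: ltW.
apply: (VP _ (Sp i)).2 => //.
by rewrite -AS (bigD1 i)//=; left.
Qed.

Section embedding.
Variable mu : {measure set E -> \bar R}.
Hypothesis muS : mu S = 1%E.

Let mS : measurable S := rV_compact_measurable cS.

Let int_ev f : mu.-integrable S (EFin \o ev f).
Proof.
apply: integrable_within_continuous => //; first by rewrite muS ltry.
exact: ev_within_continuous.
Qed.

(** The finite sum represents integration against the measure that puts the mass of [A i] at [p i].
    By Cauchy-Schwarz, [ev f] is Lipschitz with constant |f| for the feature distance. *)
Lemma embedding_approx m (A : 'I_m -> set E) (p : 'I_m -> E) (e : R) f :
  (forall i, measurable (A i)) -> trivIset [set: 'I_m] A ->
  \big[setU/set0]_(i < m) A i = S -> (forall i, S (p i)) ->
  (forall i x, A i x -> `|feature x - feature (p i)| <= e) ->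
  `|\int[mu]_(x in S) ev f x -
    dot f (\sum_i fine (mu (A i)) *: feature (p i))| <= `|f| * e.
Proof.
move=> mA tA AS Sp Ae; rewrite dot_sumr.
have fe i x : A i x -> `|ev f x - ev f (p i)| <= `|f| * e.
  move=> Ax; have Sx : S x by rewrite -AS (bigD1 i)//=; left.
  by apply: (le_trans (ev_feature_bound f Sx (Sp i))); rewrite ler_wpM2l// Ae.
have := partition_approx mA tA AS muS (int_ev f) fe.
apply: le_trans; rewrite le_eqVlt; apply/orP; left; apply/eqP.
congr (`|_ - _|); apply: eq_bigr => i _.
by rewrite dotZr dot_feature// mulrC.
Qed.

(* The discrete approximations along finer and finer partitions form a Cauchy
   sequence: test the difference of two of them against itself. *)
Lemma embedding_exists : exists m : Hk, forall f, dot f m = \int[mu]_(x in S) ev f x.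
Proof.
pose L f := \int[mu]_(x in S) ev f x.
have /choice[u uP] : forall n : nat, exists v, forall f, `|L f - dot f v| <= `|f| * n.+1%:R^-1.
  move=> n; have n0 : 0 < n.+1%:R^-1 :> R by rewrite invr_gt0.
  have [m [A [p [mA tA AS Sp Ae]]]] := feature_partition n0.
  exists (\sum_i fine (mu (A i)) *: feature (p i)) => f.
  by apply: embedding_approx => // i x /Ae[].
have uu n l : `|u n - u l| <= n.+1%:R^-1 + l.+1%:R^-1.
  set f := u n - u l; have [->|f0] := eqVneq f 0; first by rewrite normr0 addr_ge0.
  have fp : 0 < `|f| by rewrite normr_gt0.
  rewrite -(ler_pM2l fp) -expr2 -dotn {2}/f dotBr mulrDr.
  have := uP n f; have := uP l f; rewrite !ler_norml => /andP[a1 a2] /andP[b1 b2].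
  have -> : dot f (u n) - dot f (u l) = - (L f - dot f (u n)) + (L f - dot f (u l)).
    by rewrite opprB addrA subrK.
  by rewrite lerD// lerNl.
have cu : cvg (u @ \oo).
  apply/cauchy_cvgP/cauchy_exP => e e0.
  have [n _ hn] : \forall n \near \oo, 2 * n.+1%:R^-1 < e.
    have : 2 * n.+1%:R^-1 @[n --> \oo] --> (2 * 0 : R).
      by apply: cvgMr; exact: cvg_harmonic.
    by rewrite mulr0 => /cvgr_lt/(_ e e0).
  exists (u n); exists n => // l nl; rewrite -ball_normE /=.
  apply: (le_lt_trans (uu n l)); apply: le_lt_trans (hn n (leqnn n)).
  rewrite mulrDl mul1r lerD2l lef_pV2 ?posrE// ler_nat ltnS; exact: nl.
exists (lim (u @ \oo)) => f; set m := lim _.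
apply/eqP; rewrite -subr_eq0 -normr_le0; apply/ler_addgt0Pr => e e0; rewrite add0r.
have [n _ hn] : \forall n \near \oo, `|f| * (`|m - u n| + n.+1%:R^-1) < e.
  have : `|f| * (`|m - u n| + n.+1%:R^-1) @[n --> \oo] --> (`|f| * (`|m - m| + 0) : R).
    apply: cvgMr; apply: cvgD; last exact: cvg_harmonic.
    by apply: cvg_norm; apply: cvgB => //; exact: cvg_cst.
  by rewrite subrr normr0 addr0 mulr0 => /cvgr_lt/(_ e e0).
apply: le_trans (ltW (hn n (leqnn n))).
rewrite -(subrK (dot f (u n)) (dot f m)) -addrA (le_trans (ler_normD _ _))//.
rewrite mulrDr lerD//; first by rewrite -dotBr dot_norm_le.
by rewrite distrC uP.
Qed.

(** The element given by [embedding_exists] satisfies the pointwise condition defining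
    [mean_embedding], as one sees by pairing it with features. Extensionality on [S] makes it the
    only such element, so [get] returns it. *)
Lemma mean_embeddingE f :
  dot f (mean_embedding S k ev mu) = \int[mu]_(x in S) ev f x.
Proof.
have [m mP] := embedding_exists.
have mE y : S y -> (ev m y)%:E = (\int[mu]_(x in S) (k x y)%:E)%E.
  move=> Sy; rewrite -dot_feature// dotC mP /Rintegral fineK; last first.
    exact: (integrable_fin_num mS (int_ev _)).
  apply: eq_integral => x; rewrite inE => Sx.
  by have [h _] := featureP Sy; rewrite h// kC.
suff -> : mean_embedding S k ev mu = m by [].
have [_ _ ext _] := hHk; apply: ext => y Sy; apply: EFin_inj; rewrite mE//.
rewrite /mean_embedding; set M := [set m | _].
have : M (get M) by apply: getPex; exists m.
exact.
Qed.

(** Pairing the difference f with itself gives |f|^2 <= |f| e. *)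
Lemma mean_embedding_partition m (A : 'I_m -> set E) (p : 'I_m -> E) (e : R) :
  0 <= e -> (forall i, measurable (A i)) -> trivIset [set: 'I_m] A ->
  \big[setU/set0]_(i < m) A i = S -> (forall i, S (p i)) ->
  (forall i x, A i x -> `|feature x - feature (p i)| <= e) ->
  `|mean_embedding S k ev mu - \sum_i fine (mu (A i)) *: feature (p i)| <= e.
Proof.
move=> e0 mA tA AS Sp Ae; set f := (X in `|X|).
have [->|f0] := eqVneq f 0; first by rewrite normr0.
have fp : 0 < `|f| by rewrite normr_gt0.
rewrite -(ler_pM2l fp) -expr2 -dotn {2}/f dotBr mean_embeddingE.
exact: le_trans (ler_norm _) (embedding_approx f mA tA AS Sp Ae).
Qed.

End embedding.

Lemma MMD_partition_bound (mu nu : {measure set E -> \bar R}) m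
    (A : 'I_m -> set E) (p : 'I_m -> E) (e : R) :
  0 <= e -> mu S = 1%E -> nu S = 1%E ->
  (forall i, measurable (A i)) -> trivIset [set: 'I_m] A ->
  \big[setU/set0]_(i < m) A i = S -> (forall i, S (p i)) ->
  (forall i x, A i x -> `|feature x - feature (p i)| <= e) ->
  MMD S k ev mu nu <= 2 * e +
    \sum_i `|feature (p i)| * `|fine (mu (A i)) - fine (nu (A i))|.
Proof.
move=> e0 muS nuS mA tA AS Sp Ae.
have h1 := mean_embedding_partition muS e0 mA tA AS Sp Ae.
have h2 := mean_embedding_partition nuS e0 mA tA AS Sp Ae.
rewrite /MMD; move: h1 h2; set m1 := mean_embedding _ _ _ _.
set m2 := mean_embedding _ _ _ _; set u1 := \sum_i _; set u2 := \sum_i _ => h1 h2.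
have h3 : `|u1 - u2| <= \sum_i `|feature (p i)| * `|fine (mu (A i)) - fine (nu (A i))|.
  rewrite -sumrB (le_trans (ler_norm_sum _ _ _))//; apply: ler_sum => i _.
  by rewrite -scalerBl normrZ mulrC.
have -> : m1 - m2 = (m1 - u1) + (u1 - u2) + (u2 - m2) by rewrite !addrA !subrK.
apply: (le_trans (ler_normD _ _)); rewrite (distrC u2).
have := ler_normD (m1 - u1) (u1 - u2); lra.
Qed.

End rkhs.

(** * Convergence of the estimator *)

Section wmmd.
Context {R : realType} {d : nat} {Hk : completeNormedModType R}.
Local Notation E := 'rV[R]_d.
Context (S : set E) (k : E -> E -> R) (ev : Hk -> E -> R).
Hypothesis cS : compact S.
Implicit Types mu nu g : {measure set E -> \bar R}.

Lemma WMMD_ge0 mu1 mu2 : (0 <= WMMD S k ev mu1 mu2)%E.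
Proof. by rewrite adde_ge0 ?W_ge0// lee_fin normr_ge0. Qed.

Lemma WMMD_triangle mu1 mu2 mu3 :
  (mu1 S < +oo)%E -> (mu2 S < +oo)%E -> (mu3 S < +oo)%E ->
  (WMMD S k ev mu1 mu3 <= WMMD S k ev mu1 mu2 + WMMD S k ev mu2 mu3)%E.
Proof.
move=> f1 f2 f3; rewrite /WMMD addeACA -EFinD; apply: leeD.
  exact: W_triangle.
by rewrite lee_fin /MMD ler_distD.
Qed.

Lemma WMMD_symmetric mu1 mu2 : (mu1 S < +oo)%E -> (mu2 S < +oo)%E ->
  (WMMD S k ev mu1 mu2 <= WMMD S k ev mu2 mu1)%E.
Proof.
by move=> f1 f2; apply: leeD; [exact: W_symmetric|rewrite lee_fin /MMD distrC].
Qed.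

Lemma WMMD_minimizer mu nu g1 g2 :
  (mu S < +oo)%E -> (nu S < +oo)%E -> (g1 S < +oo)%E -> (g2 S < +oo)%E ->
  (WMMD S k ev nu g1 <= WMMD S k ev nu g2)%E ->
  WMMD S k ev mu g2 = 0%E ->
  (WMMD S k ev mu g1 <= WMMD S k ev mu nu + WMMD S k ev mu nu)%E.
Proof.
move=> fmu fnu fs ft h h0; apply: (le_trans (WMMD_triangle fmu fnu fs)).
rewrite leeD2l//; apply: (le_trans h).
apply: (le_trans (WMMD_triangle fnu fmu ft)); rewrite h0 adde0.
exact: WMMD_symmetric.
Qed.

End wmmd.

Section posterior.
Context {R : realType} {d : nat} {dT : measure_display} {T : measurableType dT}.
Local Notation E := 'rV[R]_d.
Context (P : probability T R) (S : set E) (F H : probability E R) (a : {posnum R})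
  (X : nat -> {mfun T >-> E}) (n N : nat)
  (Y : nat -> {mfun T >-> E}) (J : nat -> {mfun T >-> R}).
Hypotheses (mS : measurable S) (hF : F S = 1%E) (hH : H S = 1%E).
Hypotheses (n0 : (0 < n)%N) (N0 : (0 < N)%N).
Hypothesis hX : iid P (fun i => X i) F.
Hypothesis hYJ : DP_approx_draws P (fun i : 'I_n => X i : T -> E) (a%:num + n%:R)
  (fun t => post_base a H (fun i => X i t) n) N (fun i => Y i) (fun i => J i).

Let c0 : 0 < a%:num + n%:R :> R.
Proof. by rewrite addr_gt0// ltr0n. Qed.

Let Q1 t : post_base a H (fun i => X i t) n [set: E] = 1%E.
Proof.
rewrite post_base_frequency// /post_frequency probability_setT /=.
under eq_bigr do rewrite preimage_setT indicT.
rewrite sumr_const card_ord mulr1 [_ * _%:R]mulrC -mulrDl divff// gt_eqF.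
Qed.

(** The law of one atom is the mean of the random base measure, a mixture of H and F, and neither
    charges the complement of [S]. *)
Lemma post_atoms_support :
  {ae P, forall t, forall i : 'I_N, S (Y i t)}.
Proof.
apply: filter_forall => i; exists (Y i @^-1` ~` S); split => //.
- rewrite -[X in measurable X]setTI; apply: measurable_funP => //.
  exact: measurableC.
- have mSC := measurableC mS.
  have SC (G : probability E R) : G S = 1%E -> G (~` S) = 0%E.
    by move=> GS; rewrite probability_setC// GS subee.
  rewrite (DP_atom_law hYJ)//.
  under eq_integral do rewrite post_base_frequency//.
  rewrite EFin_Rintegral; last exact: bounded_measurable_post_frequency.
  have bI l : bounded_measurable (\1_(X l @^-1` ~` S) : T -> R).
    apply: bounded_measurable_indic; rewrite -[X in measurable X]setTI.
    exact: measurable_funP.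
  rewrite Rintegral_bmD; [|exact: bounded_measurable_cst|].
    rewrite Rintegral_cstT Rintegral_bmZ; last exact: bounded_measurable_sum.
    rewrite Rintegral_bm_sum// (SC H)//= mulr0 add0r big1 ?mulr0// => l _.
    rewrite Rintegral_indicT; first by rewrite (iid_marginal hX)// (SC F).
    by rewrite -[X in measurable X]setTI; exact: measurable_funP.
  by apply: bounded_measurableZ; exact: bounded_measurable_sum.
Qed.

(** Almost surely this is Fpos(A) - F(A), since the weights then lie in [0, 1] and sum to 1. The
    clamp keeps it bounded at every outcome. *)
Definition frequency_error (A : set E) t : R :=
  \sum_(i < N) Order.min `|J i t| 1 * (\1_(Y i @^-1` A) t - fine (F A)).

(** The numerator collects 2 a^2 from the prior bias, using (a / n)^2 <= a^2 / n, then 2 from the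
    sampling variance and 8 from the Dirichlet weights. *)
Lemma frequency_error_bound A : measurable A ->
  \int[P]_t (frequency_error A t ^+ 2) <=
  (2 * a%:num ^+ 2 + 10) / n%:R + 4 / N%:R.
Proof.
move=> mA; set c := a%:num + n%:R.
have nR : 0 < n%:R :> R by rewrite ltr0n.
have th01 : 0 <= fine (F A) <= 1.
  by rewrite -!lee_fin fineK ?fin_num_measure// measure_ge0 probability_le1.
have /andP[th0 th1] := th01.
have := weighted_frequency_bound N0 c0 hYJ Q1 mA
  (bounded_measurable_post_frequency X mA a H n)
  (fun t => post_base_frequency X mA a H n0 t) th0 th1.
move=> /le_trans; apply; rewrite -/c.
apply: (le_trans (lerD (post_frequency_bound hX mA a H n0) (lexx _))).
have -> : (4 * (c / N%:R) + 8) / c = 4 / N%:R + 8 / c.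
  by field; rewrite gt_eqF//= pnatr_eq0 -lt0n.
have h1 : 8 / c <= 8 / n%:R.
  by rewrite ler_pM2l// lef_pV2 ?posrE// lerDr.
have h2 : (a%:num / n%:R) ^+ 2 <= a%:num ^+ 2 / n%:R.
  rewrite expr_div_n ler_wpM2l ?sqr_ge0// lef_pV2 ?posrE ?exprn_gt0//.
  by rewrite ler_eXnr// ler1n.
have -> : (2 * a%:num ^+ 2 + 10) / n%:R =
    2 * (a%:num ^+ 2 / n%:R) + 2 / n%:R + 8 / n%:R by field; rewrite gt_eqF.
lra.
Qed.

Lemma bounded_measurable_frequency_error A : measurable A ->
  bounded_measurable (frequency_error A).
Proof.
move=> mA; apply: bounded_measurable_sum => i; apply: bounded_measurableM.
  split; first by apply: measurable_min_norm1; exact: measurable_funP.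
  by exists 1 => t; rewrite ger0_norm ?le_min ?normr_ge0 ?ler01// ge_min lexx orbT.
apply: bounded_measurableD; last exact: bounded_measurable_cst.
apply: bounded_measurable_indic; rewrite -[X in measurable X]setTI.
exact: measurable_funP.
Qed.

Lemma atomic_frequency t (A : set E) : measurable A ->
  (forall i : 'I_N, 0 <= J i t) -> \sum_(i < N) J i t = 1 ->
  atomic (fun i => Y i t) (fun i => J i t) N A =
    (fine (F A) + frequency_error A t)%:E.
Proof.
move=> mA J0 J1.
have J01 (i : 'I_N) : J i t <= 1.
  by rewrite -J1 (bigD1 i)//= lerDl sumr_ge0.
have cJ (i : 'I_N) : Order.min `|J i t| 1 = J i t.
  by rewrite ger0_norm//; apply/min_idPl.
transitivity (\sum_(i < N) (`|J i t|%:E * \d_(Y i t) A))%E; first by [].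
rewrite /frequency_error.
transitivity ((\sum_(i < N) J i t * \1_(Y i @^-1` A) t)%:E).
  rewrite -sumEFin; apply: eq_bigr => i _.
  by rewrite ger0_norm// diracE -EFinM indicE.
congr EFin; under [in RHS]eq_bigr do rewrite cJ mulrBr.
by rewrite sumrB -mulr_suml J1 mul1r addrC subrK.
Qed.

End posterior.

Theorem theorem5 (R : realType) (p d t1 : nat) (hpd : (p < d)%N)
  (S : set 'rV[R]_d) (hS : compact S)
  (* the true distribution, the prior parameters *)
  (F : probability 'rV[R]_d R) (hF : F S = 1%E)
  (a : {posnum R}) (H : probability 'rV[R]_d R) (hH : H S = 1%E)
  (* the data, and the atoms and weights of the N-term approximations *)
  (dT : measure_display) (T : measurableType dT) (P : probability T R)
  (X : nat -> {RV P >-> 'rV[R]_d}) (hX : iid P X F)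
  (Y : nat -> nat -> nat -> {RV P >-> 'rV[R]_d})
  (J : nat -> nat -> nat -> {RV P >-> R})
  (hpos : forall n N, (0 < n)%N -> (0 < N)%N ->
    DP_approx_draws P (fun i : 'I_n => X i) (a%:num + n%:R)
      (fun t => post_base a H (X ^~ t) n) N (Y n N) (J n N))
  (* the latent noise and the generators *)
  (dZ : measure_display) (TZ : measurableType dZ) (PZ : probability TZ R)
  (Z : {RV PZ >-> 'rV[R]_p})
  (hZ : product_law (fun=> normal_prob 0 1) (distribution PZ Z))
  (Omega : set 'rV[R]_t1) (hOmega : compact Omega)
  (Gen : 'rV[R]_t1 -> {mfun 'rV[R]_p >-> 'rV[R]_d})
  (* the kernel and its reproducing kernel Hilbert space *)
  (k : 'rV[R]_d -> 'rV[R]_d -> R)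
  (Hk : completeNormedModType R) (dot : {dot Hk for idfun})
  (ev : Hk -> 'rV[R]_d -> R) (hHk : is_rkhs S k dot ev) :
  let FGen w := distribution (distribution PZ Z) (Gen w) in
  let Fpos n N t := atomic (Y n N ^~ t) (J n N ^~ t) N in
  forall wstar : nat -> nat -> T -> 'rV[R]_t1,
  (forall n N, (0 < n)%N -> (0 < N)%N ->
    {ae P, forall t, Omega (wstar n N t) /\
      forall w, Omega w ->
        (WMMD S k ev (Fpos n N t) (FGen (wstar n N t))
         <= WMMD S k ev (Fpos n N t) (FGen w))%E}) ->
  (exists2 wtrue, Omega wtrue & WMMD S k ev F (FGen wtrue) = 0%E) ->
  {within S `*` S, continuous (fun xy => k xy.1 xy.2)} ->
  universal S ev ->
  (exists K : R, forall x y, `|k x y| < K) ->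
  (exists2 M : R, 0 < M & forall n, (0 < n)%N ->
    {ae P, forall t, (maxe (W S F (empirical (X ^~ t) n))
                           (W S F (post_base a H (X ^~ t) n)) < M%:E)%E}) ->
  limf_esup
    (fun nN => (\int[P]_t WMMD S k ev F (FGen (wstar nN.1 nN.2 t)))%E)
    (filter_prod \oo \oo) = 0%E.
Proof.
move=> FGen Fpos wstar hw [wtrue Owt W0] ck _ _ _.
have mS := rV_compact_measurable hS.
(* This is the base point at which test functions are centred. *)
have [x0 Sx0] : exists x, S x.
  apply: contrapT => /forallNP S0.
  have SE : S = set0 by apply/seteqP; split => // x /S0.
  by move: hF; rewrite SE measure0 => /eqP; rewrite eq_sym onee_eq0.
have Pfin (mu : probability 'rV[R]_d R) : (mu S < +oo)%E.
  by rewrite (le_lt_trans (probability_le1 _ mS))// ltry.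
apply/eqP; rewrite eq_le; apply/andP; split; last first.
  apply: limf_esup_ge0; first exact: filter_not_empty.
  by move=> nN; apply: integral_ge0 => t _; exact: WMMD_ge0.
apply/lee_addgt0Pr => e e0; rewrite add0e.
(* Discretization costs two such errors for W and two for MMD, and the minimizer bound doubles them:
   8 e / 16 = e / 2. *)
have e16 : 0 < e / 16 by rewrite divr_gt0.
have [m [A [pt [mA tA AS Sp Ae]]]] := feature_partition hS hHk ck e16.
pose C i := enorm (pt i - x0) + `|feature S k dot ev (pt i)|.
have C0 i : 0 <= C i by rewrite addr_ge0// enorm_ge0.
(* The added 1 keeps K positive even if every [C i] vanishes; [dl] is then chosen so that K dl = e /
   4. *)
pose K := 2 * (\sum_i C i + 1).
have K0 : 0 < K by rewrite mulr_gt0// ltr_wpDl// sumr_ge0.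
pose dl := e / (4 * K).
have dl0 : 0 < dl by rewrite divr_gt0// mulr_gt0.
pose r n N : R := (2 * a%:num ^+ 2 + 10) / n%:R + 4 / N%:R.
have key n N : (0 < n)%N -> (0 < N)%N ->
    (\int[P]_t WMMD S k ev F (FGen (wstar n N t))
     <= (8 * (e / 16) + K * (dl + r n N / dl))%:E)%E.
  move=> n0 N0.
  have hYJ := hpos n N n0 N0.
  pose Dt i t := frequency_error F N (Y n N) (J n N) (A i) t.
  have bD i : bounded_measurable (Dt i) by exact: bounded_measurable_frequency_error.
  have bD2 i : bounded_measurable (fun t => dl^-1 * Dt i t ^+ 2).
    by apply: bounded_measurableZ; exact: bounded_measurableM.
  (* Half of [g] dominates WMMD(F, Fpos) almost surely, by |D| <= dl + D^2 / dl. Unlike the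
     integrand that involves [wstar], [g] is known to be measurable. *)
  pose g t := 8 * (e / 16) + \sum_i 2 * C i * (dl + dl^-1 * Dt i t ^+ 2).
  have g0 t : 0 <= g t.
    apply: addr_ge0; first by rewrite mulr_ge0// ltW.
    apply: sumr_ge0 => i _; apply: mulr_ge0; first exact: mulr_ge0.
    by apply: addr_ge0; rewrite ?(ltW dl0)// mulr_ge0 ?sqr_ge0// invr_ge0 ltW.
  have bg1 i : bounded_measurable (fun t => 2 * C i * (dl + dl^-1 * Dt i t ^+ 2)).
    apply: bounded_measurableZ; apply: bounded_measurableD => //.
    exact: bounded_measurable_cst.
  have bg : bounded_measurable g.
    apply: bounded_measurableD; first exact: bounded_measurable_cst.
    exact: bounded_measurable_sum.
  apply: (@le_trans _ _ (\int[P]_t (g t)%:E)%E).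
    apply: ae_le_integral_measurable.
    - by move=> t; exact: WMMD_ge0.
    - by move=> t; rewrite lee_fin.
    - by apply/measurable_EFinP; exact: bg.1.
    have hsupp := post_atoms_support mS hF hH n0 hX hYJ.
    have c0 : 0 < a%:num + n%:R :> R by rewrite addr_gt0// ltr0n.
    have hsimp := DP_weights_simplex N0 c0 hYJ.
    apply: filterS3 (hw n N n0 N0) hsupp hsimp => t [Ow wmin] YS [J0 J1].
    have FposA B : measurable B -> Fpos n N t B =
        (fine (F B) + frequency_error F N (Y n N) (J n N) B t)%:E.
      by move=> mB; exact: atomic_frequency.
    have FposS : Fpos n N t S = 1%E.
      transitivity (\sum_(i < N) (`|J n N i t|%:E * \d_(Y n N i t) S))%E; first by [].
      transitivity ((\sum_(i < N) J n N i t)%:E); last by rewrite J1.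
      rewrite -sumEFin; apply: eq_bigr => i _.
      by rewrite ger0_norm// diracE mem_set// mule1.
    have FposS' : (Fpos n N t S < +oo)%E by rewrite FposS ltry.
    have WM : (WMMD S k ev F (Fpos n N t) <= (g t / 2)%:E)%E.
      have hW := W_partition_bound hS hF FposS mA tA AS Sp (fun i x Ax => (Ae i x Ax).1) Sx0.
      have hM := MMD_partition_bound hS hHk ck (ltW e16) hF FposS mA tA AS Sp
        (fun i x Ax => (Ae i x Ax).2).
      rewrite -lee_fin in hM; rewrite /WMMD; apply: (le_trans (leeD hW hM)).
      rewrite -EFinD lee_fin /g.
      have dE i : `|fine (F (A i)) - fine (Fpos n N t (A i))| = `|Dt i t|.
        by rewrite FposA//= opprD addNKr normrN.
      under eq_bigr do rewrite dE.
      under [X in _ + (_ + X) <= _]eq_bigr do rewrite dE.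
      have : \sum_i enorm (pt i - x0) * `|Dt i t| +
          \sum_i `|feature S k dot ev (pt i)| * `|Dt i t| <=
          (\sum_i 2 * C i * (dl + dl^-1 * Dt i t ^+ 2)) / 2.
        rewrite -big_split/= mulr_suml; apply: ler_sum => i _.
        rewrite -mulrDl -/(C i) mulrAC [2 * _]mulrC mulfK// ler_wpM2l//.
        rewrite -(ler_pM2l dl0) mulrDr mulVKf ?gt_eqF//.
        have := sqr_ge0 (dl - `|Dt i t|); rewrite sqrrB real_normK ?num_real//.
        have := mulr_ge0 (ltW dl0) (normr_ge0 (Dt i t)); lra.
      lra.
    apply: (le_trans (WMMD_minimizer hS (Pfin F) FposS' (Pfin _) (Pfin _) (wmin _ Owt) W0)).
    by apply: (le_trans (leeD WM WM)); rewrite -EFinD lee_fin -splitr.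
  rewrite EFin_Rintegral// lee_fin /g Rintegral_bmD//; last 2 first.
  - exact: bounded_measurable_cst.
  - exact: bounded_measurable_sum.
  rewrite Rintegral_cstT lerD2l Rintegral_bm_sum//.
  apply: (@le_trans _ _ (\sum_i 2 * C i * (dl + r n N / dl))).
    apply: ler_sum => i _; rewrite Rintegral_bmZ; last first.
      by apply: bounded_measurableD => //; exact: bounded_measurable_cst.
    rewrite ler_wpM2l ?mulr_ge0// Rintegral_bmD//; last exact: bounded_measurable_cst.
    rewrite Rintegral_cstT lerD2l Rintegral_bmZ; last exact: bounded_measurableM.
    rewrite mulrC ler_wpM2r ?invr_ge0 ?(ltW dl0)//.
    exact: (frequency_error_bound n0 N0 hX hYJ (mA i)).
  rewrite -mulr_suml -mulr_sumr /K ler_wpM2r ?ler_pM2l ?lerDl//.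
  rewrite addr_ge0 ?(ltW dl0)// divr_ge0 ?(ltW dl0)//.
  by rewrite addr_ge0// divr_ge0// addr_ge0// mulr_ge0// sqr_ge0.
(* For n, N >= M0 the two fractions of [r] add up to at most (2 a^2 + 10 + 4) / M0 <= dl^2, whence K
   r / dl <= K dl = e / 4. *)
pose M0 := (Num.truncn ((2 * a%:num ^+ 2 + 14) / dl ^+ 2)).+1.
rewrite limf_esupE.
(* The upper limit is an infimum over the members of the product filter, and [V] is one of them. *)
pose V := [set nN : nat * nat | (M0 <= nN.1)%N /\ (M0 <= nN.2)%N].
apply: (@le_trans _ _ (ereal_sup ((fun nN =>
  (\int[P]_t WMMD S k ev F (FGen (wstar nN.1 nN.2 t)))%E) @` V))).
  apply: ereal_inf_lbound; exists V => //.
  exists ([set n | (M0 <= n)%N], [set n | (M0 <= n)%N]) => /=; last by move=> [].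
  by split; exact: nbhs_infty_ge.
apply: ge_ereal_sup => _ [[n N] /= [Mn MN] <-].
have n0 : (0 < n)%N by exact: leq_trans Mn.
have N0 : (0 < N)%N by exact: leq_trans MN.
apply: (le_trans (key n N n0 N0)); rewrite lee_fin.
have M00 : 0 < M0%:R :> R by rewrite ltr0n.
have a20 : 0 <= a%:num ^+ 2 by exact: sqr_ge0.
have rd : r n N <= dl ^+ 2.
  apply: (@le_trans _ _ ((2 * a%:num ^+ 2 + 14) / M0%:R)).
    have hn : n%:R^-1 <= M0%:R^-1 :> R by rewrite lef_pV2 ?posrE ?ltr0n// ler_nat.
    have hN : N%:R^-1 <= M0%:R^-1 :> R by rewrite lef_pV2 ?posrE ?ltr0n// ler_nat.
    rewrite /r (_ : 2 * _ + 14 = (2 * a%:num ^+ 2 + 10) + 4); last by ring.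
    by rewrite [leRHS]mulrDl lerD// ler_wpM2l// addr_ge0// mulr_ge0.
  rewrite ler_pdivrMr// [leRHS]mulrC -ler_pdivrMr ?exprn_gt0//.
  exact: ltW (truncnS_gt _).
have Kdl : K * dl = e / 4 by rewrite /dl; field; rewrite gt_eqF.
have : K * (r n N / dl) <= e / 4.
  by rewrite -Kdl ler_pM2l// ler_pdivrMr// -expr2.
rewrite mulrDr Kdl; lra.
Qed.
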